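(* Let $K$ be a field of positive characteristic, let $X$ be an irreducible quasiprojective variety with a dominant rational self-map $\varphi: X\dashrightarrow X$, and let $f: X\dashrightarrow\mathbb{P}^1$ be a dominant rational map, all defined over $K$. Suppose that $x_0\in X(K)$ has the following properties: (1) every point in the orbit of $x_0$ under $\varphi$ avoids the indeterminacy loci of $\varphi$ and $f$; (2) $O_\varphi(x_0)$ is Zariski dense in $X$; (3) there is a finitely generated multiplicative subgroup $G$ of $K^*$ such that $f\circ\varphi^n(x_0)\in G$ for every $n\in\mathbb{N}_0$. Then there exist a nonnegative integer $d$, a rational map $\Theta: X\dashrightarrow\mathbb{G}_m^d$, and a dominant endomorphism $\Phi:\mathbb{G}_m^d\to\mathbb{G}_m^d$ such that $\Theta\circ\varphi=\Phi\circ\Theta$ as rational maps $X\dashrightarrow \mathbb{G}_m^d$. Moreover, $O_\varphi(x_0)$ avoids the indeterminacy locus of $\Theta$, and $f=g\circ\Theta$, where $g:\mathbb{G}_m^d\to\mathbb{G}_m$ is a map of the form $$g(t_1,\ldots,t_d)=C t_1^{i_1}\cdots t_d^{i_d}$$ for some $i_1,\ldots,i_d\in\mathbb{Z}$ and some $C\in G$.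
   Context: $\mathbb{N}_0=\{0,1,2,\ldots\}$. The forward orbit of $x_0$ is $O_\varphi(x_0)=\{x_0,\varphi(x_0),\varphi^2(x_0),\ldots\}$. An endomorphism of the multiplicative torus $\mathbb{G}_m^d$ here means a map of the form $(x_1,\ldots,x_d)\mapsto\left(c_1\prod_j x_j^{a_{1,j}},\ldots,c_d\prod_j x_j^{a_{d,j}}\right)$ with nonzero constants $c_i$ and integers $a_{i,j}$ (so translations are allowed; it is not required to be a group homomorphism). *)

(* Defs.v *)
From HB Require Import structures.
From mathcomp Require Import all_boot all_order all_algebra.
From mathcomp Require Export mpoly.
Set Implicit Arguments.
Unset Strict Implicit.
Unset Printing Implicit Defensive.
Import GRing.Theory.
Local Open Scope ring_scope.

(* An irreducible quasiprojective variety over K, i.e. an integral locally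
   closed subscheme V(I) \ V(b_1, ..., b_r) of P^n_K.  I is a homogeneous prime
   ideal of K[X_0, ..., X_n] other than the irrelevant one; the b_j are forms,
   finitely many being enough since the polynomial ring is Noetherian. The last
   axiom says that the variety is nonempty, hence dense in V(I). *)
Record qpvar (K : fieldType) (n : nat) := QPVar {
  videal : prime_idealr {mpoly K[n.+1]};
  vbdry : seq {mpoly K[n.+1]};
  videal_homog : forall (p : {mpoly K[n.+1]}) (e : nat),
    p \in videal -> pihomog mdeg e p \in videal;
  videal_relevant : exists i : 'I_n.+1, 'X_i \notin videal;
  vbdry_homog : {in vbdry, forall b, b \is homog mdeg};
  vnonempty : exists2 b, b \in vbdry & b \notin videal
}.

Section Ambient.
Variables (K : fieldType) (n : nat).

Definition zero_ideal : pred {mpoly K[n.+1]} := [pred p | p == 0].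

Fact zero_ideal_idealr : idealr_closed zero_ideal.
Proof.
split; rewrite ?inE ?eqxx ?oner_eq0 //.
by move=> a u v; rewrite !inE => /eqP-> /eqP->; rewrite mulr0 addr0.
Qed.

Fact zero_ideal_prime : prime_idealr_closed zero_ideal.
Proof. by move=> u v; rewrite !inE mulf_eq0. Qed.

HB.instance Definition _ := isIdealr.Build _ zero_ideal zero_ideal_idealr.
HB.instance Definition _ :=
  isPrimeIdealrClosed.Build _ zero_ideal zero_ideal_prime.

Fact zero_ideal_homog (p : {mpoly K[n.+1]}) (e : nat) :
  p \in zero_ideal -> pihomog mdeg e p \in zero_ideal.
Proof. by rewrite !inE => /eqP->; rewrite raddf0. Qed.

Fact mpolyXi_neq0 (i : 'I_n.+1) : 'X_i != 0 :> {mpoly K[n.+1]}.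
Proof.
apply/eqP=> /(congr1 (mcoeff U_(i))); rewrite mcoeffX eqxx mcoeff0 => /eqP.
by rewrite oner_eq0.
Qed.

Fact zero_ideal_relevant :
  exists i : 'I_n.+1, 'X_i \notin zero_ideal.
Proof. by exists ord0; rewrite inE mpolyXi_neq0. Qed.

Fact Pspace_bdry_homog :
  {in [:: 1 : {mpoly K[n.+1]}], forall b, b \is homog mdeg}.
Proof.
move=> b; rewrite inE => /eqP->.
by apply/homogP; exists 0%N; apply: dhomog1.
Qed.

Fact Pspace_nonempty :
  exists2 b, b \in [:: 1 : {mpoly K[n.+1]}] & b \notin zero_ideal.
Proof. by exists 1; rewrite ?inE ?oner_eq0. Qed.

Definition Pspace : qpvar K n :=
  QPVar zero_ideal_homog zero_ideal_relevant Pspace_bdry_homog Pspace_nonempty.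

Fact Gm_bdry_homog :
  {in [:: \prod_(i < n.+1) 'X_i : {mpoly K[n.+1]}],
    forall b, b \is homog mdeg}.
Proof.
move=> b; rewrite inE => /eqP->.
rewrite -big_enum.
rewrite -(big_map (fun i => 'X_i : {mpoly K[n.+1]}) xpredT id).
apply: homog_prod; apply/allP=> p /mapP[i _ ->].
by apply/homogP; exists (mdeg U_(i)%MM); rewrite dhomogX.
Qed.

Fact Gm_nonempty :
  exists2 b, b \in [:: \prod_(i < n.+1) 'X_i : {mpoly K[n.+1]}]
           & b \notin zero_ideal.
Proof.
exists (\prod_(i < n.+1) 'X_i); rewrite ?inE //.
by apply/prodf_neq0=> i _; apply: mpolyXi_neq0.
Qed.

(* The torus G_m^n as the open subset of P^n where no homogeneous coordinate
   vanishes: (t_1, ..., t_n) is the point [1 : t_1 : ... : t_n]. *)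
Definition Gm : qpvar K n :=
  QPVar zero_ideal_homog zero_ideal_relevant Gm_bdry_homog Gm_nonempty.

End Ambient.

Arguments Pspace K n : clear implicits.
Arguments Gm K n : clear implicits.

Section RationalMaps.
Variable K : fieldType.

(* K-points of P^n are represented by nonzero row vectors of homogeneous
   coordinates, up to proportionality. *)
Definition same_pt n (x y : 'rV[K]_n.+1) : Prop :=
  exists2 c : K, c != 0 & y = c *: x.

Definition on_var n (X : qpvar K n) (x : 'rV[K]_n.+1) : Prop :=
  [/\ x != 0,
      forall g, g \in videal X -> g.@[x ord0] = 0 &
      exists2 b, b \in vbdry X & b.@[x ord0] != 0].

(* F represents a rational map from X to Y, where X lies in P^n and Y in P^m:
   its m+1 components are forms of one degree, not all zero on X, and F sends
   the generic point of X into Y. *)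
Definition is_ratmap n m (X : qpvar K n) (Y : qpvar K m)
    (F : m.+1.-tuple {mpoly K[n.+1]}) : Prop :=
  [/\ exists e : nat, forall i, tnth F i \is e.-homog,
      exists i, tnth F i \notin videal X,
      forall g, g \in videal Y ->
        g \mPo F \in videal X &
      exists2 b, b \in vbdry Y & b \mPo F \notin videal X].

Definition ratmap_eq n m (X : qpvar K n) (F F' : m.+1.-tuple {mpoly K[n.+1]}) :
    Prop :=
  forall i j, tnth F i * tnth F' j - tnth F j * tnth F' i
                \in videal X.

(* Density of the image: a closed subset of Y containing it is all of Y. *)
Definition dominant n m (X : qpvar K n) (Y : qpvar K m)
    (F : m.+1.-tuple {mpoly K[n.+1]}) : Prop :=
  forall g, g \is homog mdeg -> g \mPo F \in videal X ->
    g \in videal Y.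

(* The composite E o F. Substitution represents it provided that the components
   of E do not all become zero on X, e.g. when F is dominant, or when those of
   E are nonzero monomials and F is a rational map to a torus. *)
Definition rcomp n m l (E : l.+1.-tuple {mpoly K[m.+1]})
    (F : m.+1.-tuple {mpoly K[n.+1]}) : l.+1.-tuple {mpoly K[n.+1]} :=
  [tuple tnth E i \mPo F | i < l.+1].

(* The rational map F : X --> Y is defined at x (x is outside its indeterminacy
   locus) and F(x) = y. The representative may depend on x. *)
Definition rat_at n m (X : qpvar K n) (Y : qpvar K m)
    (F : m.+1.-tuple {mpoly K[n.+1]}) (x : 'rV[K]_n.+1) (y : 'rV[K]_m.+1) :
    Prop :=
  exists F' : m.+1.-tuple {mpoly K[n.+1]},
    let v := \row_i (tnth F' i).@[x ord0] in
    [/\ is_ratmap X Y F', ratmap_eq X F F', on_var Y v & same_pt v y].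

Definition defined_at n m (X : qpvar K n) (Y : qpvar K m)
    (F : m.+1.-tuple {mpoly K[n.+1]}) (x : 'rV[K]_n.+1) : Prop :=
  exists y, rat_at X Y F x y.

(* phi^k(x) = y, all the intermediate iterates being defined. *)
Fixpoint iter_at n (X : qpvar K n) (phi : n.+1.-tuple {mpoly K[n.+1]})
    (k : nat) (x y : 'rV[K]_n.+1) : Prop :=
  if k is k'.+1 then exists2 z, iter_at X phi k' x z & rat_at X X phi z y
  else same_pt x y.

Definition forward_orbit n (X : qpvar K n) (phi : n.+1.-tuple {mpoly K[n.+1]})
    (x y : 'rV[K]_n.+1) : Prop :=
  exists k, iter_at X phi k x y.

Definition zariski_dense n (X : qpvar K n) (S : 'rV[K]_n.+1 -> Prop) : Prop :=
  forall g, g \is homog mdeg -> (forall x, S x -> g.@[x ord0] = 0) ->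
    g \in videal X.

(* The point of P^1 given by v, in the coordinate of the torus Gm K 1. *)
Definition P1pt (v : K) : 'rV[K]_2 := \row_j (if j == ord0 then 1 else v).

Section Monomial.
Variables (d e : nat) (c : 'I_e -> K) (a : 'M[int]_(e, d)).

(* Exponent of the homogeneous coordinate t_k (k = 0, ..., d) in the i-th
   component (i = 0, ..., e) of
     [1 : c_1 \prod_j (t_j / t_0)^a_1j : ... : c_e \prod_j (t_j / t_0)^a_ej]. *)
Definition mon_exp (i : 'I_e.+1) (k : 'I_d.+1) : int :=
  match unlift ord0 i, unlift ord0 k with
  | None, _ => 0
  | Some i', Some j => a i' j
  | Some i', None => - \sum_j a i' j
  end.

Definition mon_shift : nat := (\sum_i \sum_k absz (mon_exp i k))%N.

(* The map (t_1, ..., t_d) |-> (c_i \prod_j t_j ^ a_ij)_(i = 1, ..., e) from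
   G_m^d to G_m^e: the components above, cleared of negative exponents by
   multiplying all of them by (t_0 ... t_d)^mon_shift. *)
Definition monmap : e.+1.-tuple {mpoly K[d.+1]} :=
  [tuple (if unlift ord0 i is Some i' then c i' else 1)
           *: \prod_k 'X_k ^+ absz (mon_shift%:Z + mon_exp i k) | i < e.+1].

End Monomial.

Definition fg_mul_subgroup (G : {pred K}) : Prop :=
  [/\ 0 \notin G, divr_closed G &
      exists2 s : seq K, {subset s <= G} &
        forall x, x \in G ->
          exists e : 'I_(size s) -> int, x = \prod_(i < size s) s`_i ^ e i].

End RationalMaps.

(* Main.v *)
(* Write [u k] for the value of [f] at the [k]-th orbit point.  Since the orbit is
   dense, everything reduces to a multiplicative recurrence
   [u (k + d) = C * \prod_(i < d) u (k + i) ^ a i] with [d] minimal: then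
   [Theta = (f, f o phi, ..., f o phi^(d-1))] and [Phi] is a companion map.

   The functions [f o phi^i] generate a group of functions with values in [G], any
   [n + 1] of which are algebraically dependent.  Such a group has finite rank
   modulo constants.  Let [K0] be the field generated by [G]; evaluate at a generic
   ultrafilter on the orbit.  In a relation of minimal support between functions
   with values in [G], all ratios of terms are [p^m]-th powers of elements of [K0]
   for every [m], because [G] has finitely many classes modulo such powers.  So, up
   to a rank bounded by that of [G] (a nonconstant element of [K0] is detected by a
   homomorphism [K0^* -> Z], the order of a norm), functions that are not infinitely
   [p]-divisible are algebraically independent.  The infinitely [p]-divisible ones
   are divided, at each point, by a maximal power of Frobenius: one of them stops
   being a [p]-th power and becomes transcendental over the others that are still
   infinitely [p]-divisible, which allows an induction.

   Finite rank gives finitely many homomorphisms to [Z] that separate the group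
   modulo constants; since [Z^N] is Noetherian, the recurrence follows. *)
Require Import Defs.
From HB Require Import structures.
From mathcomp Require Import all_boot all_order all_algebra.
From mathcomp Require Import boolp zify ring.
From mathcomp Require filter.
Import Order.TTheory GRing.Theory Num.Theory.
Local Open Scope ring_scope.
Set Implicit Arguments.
Unset Strict Implicit.
Unset Printing Implicit Defensive.

(** * Subgroups of integer lattices *)

(** Frobenius is the obstacle: a unit equation over [G] may have infinitely many solutions obtained
    from one another by [p]-th powers, so a relation only shows that some ratio of terms is, up to a
    fixed constant, a [p^m]-th power for every [m]. Elements of [K0] that are such powers for all
    [m] are algebraic over the prime field, hence periodic under Frobenius; a function of the group
    with such values takes finitely many of them and is therefore constant. The coefficients of
    relations lie in [K], possibly much larger than [K0]; minimality of the support makes them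
    unique, hence defined over every [K0^(p^m)] after rescaling the functions. That rescaling
    depends on [m]: the ultrafilter selects one class of values for all [m] at once and still
    ignores proper closed subsets. Finite rank alone would not give finite generation, as [Z[1/p]]
    shows; comparing values at two points through homomorphisms [K0^* -> Z] removes such
    divisibility. *)

Definition subgroup (V : zmodType) (A : V -> Prop) :=
  A 0 /\ forall x y, A x -> A y -> A (x - y).

Section Subgroup.
Variables (V : zmodType) (A : V -> Prop).
Hypothesis hA : subgroup A.

Lemma subgroup0 : A 0. Proof. by case: hA. Qed.
Lemma subgroupB x y : A x -> A y -> A (x - y). Proof. by case: hA => _; apply. Qed.
Lemma subgroupN x : A x -> A (- x).
Proof. by move=> Ax; rewrite -sub0r; apply: subgroupB => //; apply: subgroup0. Qed.
Lemma subgroupD x y : A x -> A y -> A (x + y).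
Proof. by move=> Ax Ay; rewrite -[y]opprK; apply/subgroupB/subgroupN. Qed.
Lemma subgroupMz x (z : int) : A x -> A (x *~ z).
Proof.
move=> Ax; have h n : A (x *+ n).
  by elim: n => [|n IH]; rewrite ?mulr0n ?mulrS; [apply: subgroup0 | apply: subgroupD].
by case: z => n; [apply: h | apply/subgroupN/h].
Qed.
End Subgroup.

Lemma int_ideal_principal (J : int -> Prop) : subgroup J ->
  exists2 z, J z & forall x, J x -> exists q, x = q * z.
Proof.
move=> hJ; pose P n := `[< (0 < n)%N /\ J n%:Z >].
have [[n0 Pn0]|noP] := pselect (exists n, P n); last first.
  exists 0; first exact: subgroup0.
  move=> x Jx; exists 0; rewrite mul0r; apply/eqP; apply/negPn/negP=> x0.
  apply: noP; exists `|x|%N; apply/asboolP; split; first by rewrite absz_gt0.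
  by case/intP: x Jx {x0} => [|n|n] Jx; rewrite ?abszN //; move/(subgroupN hJ): Jx; rewrite opprK.
have ex : exists n, P n by exists n0.
case: (ex_minnP ex) => m /asboolP[m0 Jm] mmin.
exists m%:Z => // x Jx; exists (x %/ m%:Z)%Z.
rewrite {1}(divz_eq x m); have [->|r0] := eqVneq (x %% m)%Z 0; first by rewrite addr0.
have rge : (0 <= x %% m)%Z by apply: modz_ge0; rewrite -lt0n in m0 *; lia.
have rlt : (x %% m < m)%Z by apply: ltz_pmod.
have Jr : J (x %% m)%Z.
  rewrite /modz; apply: subgroupB => //.
  by rewrite mulrC -mulrzz; apply: subgroupMz.
have r1 : ((0 < `|(x %% m)%Z|)%N) by rewrite absz_gt0.
have := mmin `|(x %% m)%Z|%N; have Pr : P `|(x %% m)%Z|%N by apply/asboolP; split; rewrite // gez0_abs.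
by move/(_ Pr); lia.
Qed.

Lemma int_subgroup_fg n (A : 'rV[int]_n -> Prop) : subgroup A ->
  exists2 B : 'M[int]_n, (forall i, A (row i B)) &
    forall a, A a -> exists c, a = c *m B.
Proof.
elim: n A => [|n IH] A hA.
  exists 0; first by case.
  by move=> a _; exists 0; rewrite [a]thinmx0 mul0mx.
pose J z := exists2 a : 'rV_n.+1, A a & a 0 0 = z.
have hJ : subgroup J.
  split; first by exists 0; [apply: subgroup0 | rewrite mxE].
  move=> x y [a Aa <-] [b Ab <-]; exists (a - b); first exact: subgroupB.
  by rewrite !mxE.
have [z [a0 Aa0 a0z] Jz] := int_ideal_principal hJ.
pose A' (b : 'rV[int]_n) := A (row_mx 0 b : 'rV_(1 + n)).
have hA' : subgroup A'.
  split; first by rewrite /A' row_mx0; apply: subgroup0.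
  move=> x y Ax Ay; have : A (row_mx 0 x - row_mx 0 y : 'rV_(1 + n)) by apply: subgroupB.
  by rewrite opp_row_mx add_row_mx subr0.
have [B' hB' genB'] := IH _ hA'.
pose B : 'M[int]_(1 + n) := col_mx (a0 : 'rV_(1 + n)) (row_mx 0 B').
have AB (i : 'I_(1 + n)) : A (row i B).
  case: (split_ordP i) => j ->; first by rewrite rowKu row_id.
  by rewrite rowKd row_row_mx linear0; apply: hB'.
exists B => //.
move=> a Aa; have [q aq] : exists q, a 0 0 = q * z by apply: Jz; exists a.
pose b : 'rV_(1 + n) := a - q *: a0.
have Ab : A b.
  by apply: subgroupB => //; rewrite -[q]intz scaler_int; apply: subgroupMz.
have b0 : lsubmx b = 0.
  apply/matrixP=> i j; rewrite !ord1 !mxE.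
  have -> : lshift n (0 : 'I_1) = 0 :> 'I_n.+1 by apply/val_inj.
  by rewrite aq a0z subrr.
have [c bc] : exists c, rsubmx b = c *m B'.
  by apply: genB'; rewrite /A' -b0 hsubmxK.
exists (row_mx q%:M c : 'rV_(1 + n)).
have -> : row_mx q%:M c *m B = q *: a0 + b.
  by rewrite [LHS]mul_row_col mul_scalar_mx mul_mx_row mulmx0 -bc -b0 hsubmxK.
by rewrite addrC subrK.
Qed.

(** The span of all the [E i] is generated by finitely many vectors, which involve only the first
    [D] terms for some [D]; so [E D] is a combination of its predecessors. *)
Lemma int_seq_acc n (E : nat -> 'rV[int]_n) :
  exists d, exists c : 'I_d -> int, E d = \sum_(i < d) E i *~ c i.
Proof.
pose A a := exists d, exists c : 'I_d -> int, a = \sum_(i < d) E i *~ c i.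
have wide d d' (c : 'I_d -> int) : (d <= d')%N ->
    exists c' : 'I_d' -> int, \sum_(i < d) E i *~ c i = \sum_(i < d') E i *~ c' i.
  move=> le; exists (fun i => if insub (i : nat) is Some j then c j else 0).
  rewrite -!(big_mkord xpredT (fun i => E i *~ (if insub i is Some j then c j else 0))).
  rewrite (big_cat_nat (n := d)) //= [X in _ + X]big_nat_cond [X in _ + X]big1 ?addr0.
    by rewrite big_mkord; apply: eq_bigr => i _; rewrite valK.
  by move=> i /andP[/andP[di _] _]; rewrite insubF ?mulr0z // ltnNge di.
have hA : subgroup A.
  split; first by exists 0%N, (fun=> 0); rewrite big_ord0.
  move=> x y [d [c ->]] [d' [c' ->]].
  have [c1 ->] := wide _ (maxn d d') c (leq_maxl _ _).
  have [c2 ->] := wide _ (maxn d d') c' (leq_maxr _ _).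
  exists (maxn d d'), (fun i => c1 i - c2 i); rewrite -sumrB.
  by apply: eq_bigr => i _; rewrite mulrzBr.
have [B hB genB] := int_subgroup_fg hA.
have [dB hdB] := choice hB.
pose D := (\max_i dB i)%N.
have rowB i : exists c : 'I_D -> int, row i B = \sum_(j < D) E j *~ c j.
  by have [c ->] := hdB i; apply: wide; apply: leq_bigmax.
have AE : A (E D).
  exists D.+1, (fun i => (i == D :> nat)%:R); rewrite big_ord_recr /= eqxx mulr1z.
  by rewrite big1 ?add0r // => i _; rewrite ltn_eqF // mulr0z.
have [cc hc] := choice rowB.
have [e Ee] := genB _ AE; exists D, (fun j => \sum_i e 0 i * cc i j).
rewrite Ee mulmx_sum_row; under eq_bigr => i _ do rewrite hc scaler_sumr.
rewrite exchange_big /=; apply: eq_bigr => j _.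
rewrite mulrz_sumr; apply: eq_bigr => i _.
by rewrite -[e 0 i in LHS]intz scaler_int -mulrzA mulrC.
Qed.

(* Greedy choice of coordinates: [I] is a maximal set of coordinates meeting [A]
   trivially, so every other coordinate yields an element of [A]. *)
Lemma subgroup_coordinates t (A : 'rV[int]_t -> Prop) : subgroup A ->
  exists I : {set 'I_t},
    (forall a, A a -> (forall j, j \notin I -> a 0 j = 0) -> a = 0) /\
    forall j, j \notin I -> exists2 a, A a &
      a 0 j != 0 /\ forall i, i \notin I -> i != j -> a 0 i = 0.
Proof.
move=> hA.
pose P (I : {set 'I_t}) :=
  `[< forall a, A a -> (forall j, j \notin I -> a 0 j = 0) -> a = 0 >].
have P0 : P set0.
  by apply/asboolP => a _ h; apply/rowP => j; rewrite h ?inE // mxE.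
have [I /maxsetP[PI maxI] _] := maxset_exists P0.
exists I; split; first exact/asboolP.
move=> j jI; have /existsNP[a /not_implyP[Aa /not_implyP[ha a0]]] :
    ~ forall a, A a -> (forall i, i \notin j |: I -> a 0 i = 0) -> a = 0.
  move=> /asboolP/maxI/(_ (subsetUr _ _))/setP/(_ j).
  by rewrite !inE eqxx (negbTE jI).
exists a => //; split.
  apply/eqP => aj0; apply: a0; move/asboolP: PI; apply => // i iI.
  by have [->//|ij] := eqVneq i j; apply: ha; rewrite !inE negb_or ij.
by move=> i iI ij; apply: ha; rewrite !inE negb_or ij.
Qed.

(** The coordinates in the maximal set [I] give the first alternative, those outside it the second.
    Every rank count below uses this dichotomy, with [A] the exponents of monomials that degenerate
    in some sense. *)
Lemma subgroup_rank t s s' (A : 'rV[int]_t -> Prop) :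
    subgroup A -> (s + s' <= t.+1)%N -> (0 < s')%N ->
  (exists M : 'M[int]_(s, t), forall b, A (b *m M) -> b = 0) \/
  (exists2 M : 'M[int]_(s', t), (forall i, A (row i M)) &
     forall b : 'rV_s', b *m M = 0 -> b = 0).
Proof.
move=> hA le s'0; have [I [indI hI]] := subgroup_coordinates hA.
have [leI|ltI] := leqP s #|I|.
  left; exists (\matrix_(i, j) (j == enum_val (widen_ord leI i))%:R) => b Ab.
  have bE i : (b *m (\matrix_(i, j) (j == enum_val (widen_ord leI i))%:R)) 0
      (enum_val (widen_ord leI i)) = b 0 i.
    rewrite mxE (bigD1 i) //= mxE eqxx mulr1 big1 ?addr0 // => k ki.
    rewrite mxE (inj_eq enum_val_inj) -val_eqE /= [_ == _ :> nat]eq_sym.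
    by rewrite val_eqE (negbTE ki) mulr0.
  have b0 := indI _ Ab; apply/rowP => i; rewrite -bE b0 ?mxE //.
  move=> j jI; rewrite mxE big1 // => k _; rewrite mxE.
  by case: eqP jI => [->|]; rewrite ?enum_valP ?mulr0.
right; have leC : (s' <= #|~: I|)%N.
  by have := cardsC I; rewrite card_ord; lia.
pose jj (i : 'I_s') := enum_val (widen_ord leC i).
have jjI i : jj i \notin I by have := enum_valP (widen_ord leC i); rewrite inE.
have jj_inj : injective jj.
  by move=> i k /enum_val_inj/(congr1 val)/= /val_inj.
have hex i : exists a, A a /\
    (a 0 (jj i) != 0 /\ forall k, k \notin I -> k != jj i -> a 0 k = 0).
  by have [a ? ?] := hI _ (jjI i); exists a.
have [a ha] := choice hex.
(* On the columns [jj] this matrix is diagonal with nonzero entries. *)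
exists (\matrix_(i < s') a i) => [i|b b0]; first by rewrite rowK; case: (ha i).
apply/rowP => i; have /rowP/(_ (jj i)) := b0; rewrite !mxE (bigD1 i) //= big1.
  by rewrite !mxE addr0 => /eqP; rewrite mulf_eq0 (negbTE (ha i).2.1) orbF => /eqP.
move=> k ki; rewrite mxE (ha k).2.2 ?mulr0 ?jjI //.
by rewrite (inj_eq jj_inj) eq_sym.
Qed.

(** * Generated subfields and norms *)

Section GeneratedField.
Variable K : fieldType.
Implicit Types (A : K -> Prop) (k : divringClosed K).

Definition genf A : {pred K} := [pred x | `[< forall k : {pred K},
  GRing.divring_closed k -> (forall a, A a -> a \in k) -> x \in k >]].

Lemma genfP A x : reflect (forall k : {pred K},
  GRing.divring_closed k -> (forall a, A a -> a \in k) -> x \in k) (x \in genf A).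
Proof. exact: asboolP. Qed.

Fact genf_closed A : GRing.divring_closed (genf A).
Proof.
split=> [|x y /genfP hx /genfP hy|x y /genfP hx /genfP hy].
- by apply/genfP => k [].
- by apply/genfP => k hk hA; case: (hk) => _ h _; apply: h; [apply: hx|apply: hy].
- by apply/genfP => k hk hA; case: (hk) => _ _ h; apply: h; [apply: hx|apply: hy].
Qed.

HB.instance Definition _ A := GRing.isDivringClosed.Build K (genf A) (genf_closed A).

Lemma sub_genf A a : A a -> a \in genf A.
Proof. by move=> Aa; apply/genfP => k _; apply. Qed.

Lemma genf_min A k : (forall a, A a -> a \in k) -> {subset genf A <= k}.
Proof.
move=> hA x /genfP; apply=> //; split; first exact: rpred1.
  by move=> ? ? *; apply: rpredB.
by move=> ? ? *; apply: rpred_div.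
Qed.

Lemma genfS A B : (forall a, A a -> B a) -> {subset genf A <= genf B}.
Proof. by move=> AB; apply: genf_min => a /AB/sub_genf. Qed.

Definition adjoin k (a : K) := genf (fun x => x \in k \/ x = a).

Lemma adjoinP k a x : x \in adjoin k a ->
  exists P Q, [/\ P \is a polyOver k, Q \is a polyOver k, Q.[a] != 0 & x = P.[a] / Q.[a]].
Proof.
pose S x := `[< exists P Q,
  [/\ P \is a polyOver k, Q \is a polyOver k, Q.[a] != 0 & x = P.[a] / Q.[a]] >].
move=> /genfP/(_ [pred x | S x]) h; apply/asboolP; apply: h; last first.
  move=> b [bk|->]; apply/asboolP.
    exists b%:P, 1; rewrite polyOverC bk rpred1 !hornerE oner_eq0.
    by split; rewrite // divr1.
  exists 'X, 1; rewrite polyOverX rpred1 !hornerE oner_eq0.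
  by split; rewrite // ?divr1.
split=> [|y z|y z].
- apply/asboolP.
  exists 1, 1; rewrite rpred1 !hornerE oner_eq0.
  by split; rewrite ?invr1.
- move=> /asboolP[P [Q [hP hQ Q0 ->]]] /asboolP[P' [Q' [hP' hQ' Q'0 ->]]].
  apply/asboolP; exists (P * Q' - P' * Q), (Q * Q'); rewrite !hornerE.
  split; [by rewrite rpredB ?rpredM|exact: rpredM|by rewrite mulf_neq0|].
  by field; rewrite Q0 Q'0.
- move=> /asboolP[P [Q [hP hQ Q0 ->]]] /asboolP[P' [Q' [hP' hQ' Q'0 ->]]].
  apply/asboolP; have [P'0|P'0] := eqVneq P'.[a] 0.
    exists 0, 1; rewrite rpred0 rpred1 !hornerE oner_eq0 P'0 mul0r invr0 mulr0.
    by split.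
  exists (P * Q'), (Q * P'); rewrite !hornerE.
  split; [exact: rpredM|exact: rpredM|by rewrite mulf_neq0|].
  by field; rewrite P'0 Q0 Q'0.
Qed.

Lemma polyOver_edivp k (M Q : {poly K}) :
    M \is monic -> M \is a polyOver k -> Q \is a polyOver k ->
  exists D R : {poly K}, [/\ D \is a polyOver k, R \is a polyOver k,
    (size R < size M)%N & Q = D * M + R].
Proof.
move=> monM Mk; have [n] := ubnP (size Q).
elim: n Q => // n IH Q; rewrite ltnS => szQ Qk.
have [ltQ|leM] := ltnP (size Q) (size M).
  by exists 0, Q; rewrite mul0r add0r rpred0.
have M0 : M != 0 by apply: monic_neq0.
have Q0 : Q != 0 by rewrite -size_poly_gt0 (leq_trans _ leM) // size_poly_gt0.
pose T := lead_coef Q *: 'X^(size Q - size M).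
have Tk : T \is a polyOver k.
  by apply: polyOverZ; [move/polyOverP: Qk; apply | apply: rpredX; apply: polyOverX].
have szTM : size (T * M) = size Q.
  rewrite size_Mmonic //; last first.
    by rewrite scaler_eq0 lead_coef_eq0 (negbTE Q0) /= monic_neq0 ?monicXn.
  by rewrite /T size_scale ?lead_coef_eq0 // size_polyXn addSn /= subnK.
have ltR : (size (Q - T * M)%R < size Q)%N.
  have lcTM : lead_coef (T * M) = lead_coef Q.
    by rewrite lead_coef_Mmonic // lead_coefZ lead_coefXn mulr1.
  rewrite -(prednK (n := size Q)) ?size_poly_gt0 // ltnS; apply/leq_sizeP => j lej.
  rewrite coefB; have [->|jn] := eqVneq j (size Q).-1.
    by rewrite -[X in _ - (T * M)`_X.-1]szTM -!lead_coefE lcTM subrr.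
  have ltj : (size Q <= j)%N by move: lej jn (size_poly_gt0 Q); rewrite Q0; lia.
  by rewrite !nth_default ?subrr ?szTM.
have [D [R [Dk Rk szR E]]] := IH (Q - T * M) (leq_trans ltR szQ) (rpredB Qk (rpredM Tk Mk)).
exists (D + T), R; split=> //; first exact: rpredD.
by rewrite mulrDl addrAC -E subrK.
Qed.

Lemma minpoly_over k (x : K) (P : {poly K}) :
    P \is a polyOver k -> P != 0 -> root P x ->
  exists M, [/\ M \is monic, M \is a polyOver k, root M x, (size M <= size P)%N &
    forall Q, Q \is a polyOver k -> root Q x -> M %| Q].
Proof.
move=> Pk P0 Px.
pose ok n := `[< exists M : {poly K},
  [/\ M \is a polyOver k, M != 0, root M x & size M = n] >].
have ex : exists n, ok n by exists (size P); apply/asboolP; exists P.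
case: (ex_minnP ex) => n /asboolP[M [Mk M0 Mx szM]] nmin.
have lM0 : lead_coef M != 0 by rewrite lead_coef_eq0.
exists ((lead_coef M)^-1 *: M).
have Mk' : (lead_coef M)^-1 *: M \is a polyOver k.
  by apply: polyOverZ => //; rewrite rpredV; move/polyOverP: Mk; apply.
have monM : (lead_coef M)^-1 *: M \is monic.
  by rewrite monicE lead_coefZ mulVf.
split=> //.
- by rewrite rootE hornerZ (rootP Mx) mulr0.
- by rewrite size_scale ?invr_eq0 // szM; apply: nmin; apply/asboolP; exists P.
move=> Q Qk Qx; have [D [R [Dk Rk szR E]]] := polyOver_edivp monM Mk' Qk.
have [R0|R0] := eqVneq R 0; first by rewrite E R0 addr0 dvdp_mull.
move: szR; rewrite size_scale ?invr_eq0 // szM ltnNge nmin //.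
apply/asboolP; exists R; split=> //; move/rootP: Qx.
by rewrite E hornerD hornerM hornerZ (rootP Mx) !mulr0 add0r => /eqP.
Qed.

Lemma mem_adjoin k a b : b \in k -> b \in adjoin k a.
Proof. by move=> bk; apply: sub_genf; left. Qed.

Lemma adjoin_gen k a : a \in adjoin k a.
Proof. by apply: sub_genf; right. Qed.

Lemma det_polyOver k n (A : 'M[K]_n) : (forall i j, A i j \in k) -> \det A \in k.
Proof.
move=> hA; apply: rpred_sum => s _; apply: rpredM.
  by apply: rpredX; rewrite rpredN rpred1.
by apply: rpred_prod.
Qed.

Lemma horner_mx_over k n (A : 'M[K]_n.+1) (P : {poly K}) :
  A \is a mxOver k -> P \is a polyOver k -> horner_mx A P \is a mxOver k.
Proof.
move=> hA; elim/poly_ind: P => [|P c IH]; first by rewrite rmorph0 mxOver0 ?rpred0.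
move=> hP; have hc : c \in k.
  by move/polyOverP/(_ 0%N): hP; rewrite coefD coefMX coefC add0r.
have hP' : P \is a polyOver k.
  apply/polyOverP => i; move/polyOverP/(_ i.+1): hP.
  by rewrite coefD coefMX coefC addr0.
rewrite rmorphD rmorphM /= horner_mx_X horner_mx_C.
have h1 : horner_mx A P *m A \is a mxOver k by apply: mxOverM; rewrite ?IH.
apply/mxOverP => i j; rewrite mxE; apply: rpredD; first by move/mxOverP: h1; apply.
by rewrite mxE rpredMn.
Qed.

(* The norm of [k(x)] over [k], computed on the companion matrix of the minimal
   polynomial of [x]. *)
Lemma norm_exists k (x : K) (P0 : {poly K}) :
    P0 \is a polyOver k -> P0 != 0 -> root P0 x ->
  exists d (N : K -> K), [/\ (0 < d)%N,
    forall y, y \in adjoin k x -> y != 0 -> N y \in k /\ N y != 0,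
    forall y z, y \in adjoin k x -> z \in adjoin k x -> N (y * z) = N y * N z &
    forall c, c \in k -> N c = c ^+ d].
Proof.
move=> P0k P00 P0x; have [M [monM Mk Mx _ minM]] := minpoly_over P0k P00 P0x.
have M0 := monic_neq0 monM.
have [n [A [Ak AM]]] : exists n (A : 'M[K]_n.+1), A \is a mxOver k /\ horner_mx A M = 0.
  have [n szM] : exists n, (size M).-1 = n.+1.
    exists (size M).-2; rewrite prednK // -ltnS prednK ?size_poly_gt0 //.
    exact: root_size_gt1 Mx.
  have Ck : companionmx M \is a mxOver k.
    apply/mxOverP => i j; rewrite mxE; case: ifP => _; last exact: rpred_nat.
    by rewrite rpredN; move/polyOverP: Mk; apply.
  have := companionmxK monM; move: (companionmx M) Ck; rewrite szM => A Ak chA.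
  by exists n, A; split; rewrite // -chA Cayley_Hamilton.
(* Bezout modulo the minimal polynomial: take a combination of [Q] and [M] of least size among those
   not vanishing at [x]. Dividing [M] by it leaves a remainder that vanishes at [x], so the quotient
   vanishes there too and is a multiple of [M]; the combination is constant. *)
have inv Q : Q \is a polyOver k -> ~~ root Q x ->
    exists2 R, R \is a polyOver k & exists V, R * Q = 1 + V * M.
  move=> Qk Qx.
  pose ok m := `[< exists S U V : {poly K}, [/\ S \is a polyOver k, U \is a polyOver k,
    S = U * Q + V * M, ~~ root S x & size S = m] >].
  have ex : exists m, ok m.
    by exists (size Q); apply/asboolP; exists Q, 1, 0; rewrite mul1r mul0r addr0 rpred1.
  case: (ex_minnP ex) => m /asboolP[S [U [V [Sk Uk SE Sx szS]]]] mmin.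
  have S0 : S != 0 by apply: contraNneq Sx => ->; apply: root0.
  have lS0 : lead_coef S != 0 by rewrite lead_coef_eq0.
  pose S' := (lead_coef S)^-1 *: S.
  have lSk : (lead_coef S)^-1 \in k by rewrite rpredV; move/polyOverP: Sk; apply.
  have S'k : S' \is a polyOver k by apply: polyOverZ.
  have monS : S' \is monic by rewrite monicE lead_coefZ mulVf.
  have [D [R [Dk Rk szR E]]] := polyOver_edivp monS S'k Mk.
  have Rx : root R x.
    apply/negPn/negP => nRx; move: szR; rewrite size_scale ?invr_eq0 // szS ltnNge mmin //.
    apply/asboolP; exists R, (- (D * ((lead_coef S)^-1 *: U))),
      (1 - D * ((lead_coef S)^-1 *: V)).
    split=> //; first by rewrite rpredN rpredM ?polyOverZ.
    apply: (addrI (D * S')); rewrite -E /S' SE -!mul_polyC; ring.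
  have Dx : root D x.
    move/rootP: Mx; rewrite E hornerD hornerM (rootP Rx) addr0 => /eqP.
    by rewrite mulf_eq0 [S'.[x] == 0](_ : _ = false) ?orbF // hornerZ mulf_eq0
         invr_eq0 (negbTE lS0) -[_ == 0]/(root S x) (negbTE Sx).
  have leSM : (size S < size M)%N.
    have [D' [R' [D'k R'k szR' E']]] := polyOver_edivp monM Mk Sk.
    apply: leq_ltn_trans szR'; rewrite szS; apply: mmin; apply/asboolP.
    exists R', U, (V - D'); split=> //.
      by apply: (addrI (D' * M)); rewrite -E' SE; ring.
    by move: Sx; rewrite !rootE E' hornerD hornerM (rootP Mx) mulr0 add0r.
  have szS' : size S' = size S by rewrite size_scale ?invr_eq0.
  have D0 : D != 0.
    by apply: contraTneq szR => D0; rewrite -leqNgt szS' -[R]add0r -(mul0r S') -D0 -E ltnW.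
  have szDS : size (D * S') = (size D + size S').-1 by rewrite size_Mmonic.
  have szS'0 : (0 < size S')%N by rewrite size_poly_gt0 monic_neq0.
  have szM : size M = size (D * S').
    rewrite E size_polyDl // szDS (leq_trans szR) //.
    have := D0; rewrite -size_poly_gt0; move: (size D) (size S') => a b; clear; lia.
  have leMD : (size M <= size D)%N by apply: dvdp_leq => //; apply: minM.
  have S'1 : S' = 1.
    have le1 : (size S' <= 1)%N.
      move: szM leMD szS'0; rewrite szDS.
      by move: (size D) (size M) (size S') => a b c; clear; lia.
    move: (monS); rewrite [S'](size1_polyC le1) monicE lead_coefC => /eqP ->.
    exact: polyC1.
  exists ((lead_coef S)^-1 *: U); first exact: polyOverZ.
  by exists (- ((lead_coef S)^-1 *: V)); rewrite -S'1 /S' SE -!mul_polyC; ring.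
have poly_of y : exists R, y \in adjoin k x -> R \is a polyOver k /\ R.[x] = y.
  have [/adjoinP[P [Q [Pk Qk Qx ->]]]|ny] := boolP (y \in adjoin k x); last by exists 0.
  have [R Rk [V RE]] := inv _ Qk Qx.
  exists (P * R) => _; split; first exact: rpredM.
  have /(congr1 (fun P => P.[x])) := RE.
  rewrite hornerM hornerD hornerM (rootP Mx) hornerC mulr0 addr0 => RQ.
  by rewrite [(P * R).[x]]hornerM -[R.[x]](mulfK Qx) RQ mul1r.
have [r hr] := choice poly_of.
(* So [P.[x] |-> horner_mx A P] is a well-defined matrix representation of [adjoin k x]. *)
have eqA P Q : P \is a polyOver k -> Q \is a polyOver k -> P.[x] = Q.[x] ->
    horner_mx A P = horner_mx A Q.
  move=> Pk Qk PQ; apply/eqP; rewrite -subr_eq0 -rmorphB /=.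
  have /dvdpP[D ->] : M %| P - Q.
    by apply: minM; rewrite ?rpredB // rootE hornerD hornerN PQ subrr.
  by rewrite rmorphM /= AM mulr0.
exists n.+1, (fun y => \det (horner_mx A (r y))); split=> //.
- move=> y yk y0; have [ryk ryx] := hr _ yk; split.
    by apply: det_polyOver; apply/mxOverP; apply: horner_mx_over.
  have nrt : ~~ root (r y) x by rewrite rootE ryx.
  have [R Rk [V /(congr1 (horner_mx A))]] := inv _ ryk nrt.
  rewrite rmorphD !rmorphM /= rmorph1 AM mulr0 addr0 => /(congr1 determinant).
  rewrite det_mulmx det1 => /eqP; apply: contraTneq => ->.
  by rewrite mulr0 eq_sym oner_eq0.
- move=> y z yk zk; have [ryk ryx] := hr _ yk; have [rzk rzx] := hr _ zk.
  have [rk rx] := hr _ (rpredM yk zk).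
  rewrite (eqA _ (r y * r z)) ?rpredM // ?hornerM ?ryx ?rzx //.
  by rewrite rmorphM /= det_mulmx.
- move=> c ck; have [rk rx] := hr _ (mem_adjoin x ck).
  rewrite (eqA _ c%:P) ?polyOverC ?hornerC //.
  by rewrite horner_mx_C det_scalar.
Qed.

End GeneratedField.

(** * Homomorphisms from the multiplicative group to the integers *)

Section Frobenius.
Variables (K : idomainType) (p : nat) (hp : p \in [pchar K]).

Lemma pchar_expD m (x y : K) : (x + y) ^+ (p ^ m) = x ^+ (p ^ m) + y ^+ (p ^ m).
Proof.
elim: m => [|m IH]; first by rewrite !expr1.
by rewrite expnSr !exprM IH -!(pFrobenius_autE hp) rmorphD.
Qed.

Lemma pchar_exp0 m : (0 : K) ^+ (p ^ m) = 0.
Proof. by rewrite expr0n expn_eq0 (gtn_eqF (prime_gt0 (pcharf_prime hp))). Qed.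

Lemma pchar_expN m (x : K) : (- x) ^+ (p ^ m) = - x ^+ (p ^ m).
Proof. by apply/eqP; rewrite -addr_eq0 -pchar_expD addrC subrr pchar_exp0. Qed.

Lemma pchar_exp_sum m (I : Type) (r : seq I) (P : pred I) (F : I -> K) :
  (\sum_(i <- r | P i) F i) ^+ (p ^ m) = \sum_(i <- r | P i) F i ^+ (p ^ m).
Proof. by apply: (big_morph (fun x => x ^+ (p ^ m))); [apply: pchar_expD|apply: pchar_exp0]. Qed.

Lemma pchar_exp_inj m : injective (fun x : K => x ^+ (p ^ m)).
Proof.
move=> x y /= /eqP; rewrite -subr_eq0 -pchar_expN -pchar_expD expf_eq0 subr_eq0.
by case/andP => _ /eqP.
Qed.

End Frobenius.

Section Homomorphisms.
Variable K : fieldType.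
Implicit Types (k : divringClosed K) (v : K -> int).

Definition homon (F : {pred K}) v := forall a b,
  a \in F -> b \in F -> a != 0 -> b != 0 -> v (a * b) = v a + v b.

Lemma homonS (F F' : {pred K}) v : {subset F' <= F} -> homon F v -> homon F' v.
Proof. by move=> sF hv a b /sF aF /sF bF; apply: hv. Qed.

Lemma homonX k v a n : homon k v -> a \in k -> a != 0 -> v (a ^+ n) = v a *+ n.
Proof.
move=> hv ak a0; have v1 : v 1 = 0.
  have := hv _ _ (rpred1 k) (rpred1 k) (oner_neq0 _) (oner_neq0 _); rewrite mulr1 => /eqP.
  by rewrite -{1}[v 1]addr0 (inj_eq (addrI _)) => /eqP/esym.
elim: n => [|n IH]; first by rewrite expr0 mulr0n.
by rewrite exprS hv ?rpredX ?expf_neq0 // IH mulrS.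
Qed.

Lemma homon1 k v : homon k v -> v 1 = 0.
Proof. by move=> hv; rewrite -(expr0 1) (homonX _ hv) ?rpred1 ?oner_neq0. Qed.

Lemma homonV k v a : homon k v -> a \in k -> a != 0 -> v a^-1 = - v a.
Proof.
move=> hv ak a0; apply/eqP; rewrite -addr_eq0 -hv ?invr_neq0 ?rpredV // mulVf //.
by rewrite (homon1 hv).
Qed.

Lemma homonZ k v a z : homon k v -> a \in k -> a != 0 -> v (a ^ z) = v a *~ z.
Proof.
move=> hv ak a0; case: z => n; first exact: homonX hv _ _.
by rewrite NegzE -exprnN (homonV hv) ?rpredX ?expf_neq0 // (homonX _ hv) // mulrNz.
Qed.

Lemma homon_prod k v (I : Type) (r : seq I) (P : pred I) (F : I -> K) :
  homon k v -> (forall i, F i \in k) -> (forall i, F i != 0) ->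
  v (\prod_(i <- r | P i) F i) = \sum_(i <- r | P i) v (F i).
Proof.
move=> hv hF F0; elim: r => [|i r IH]; first by rewrite !big_nil (homon1 hv).
rewrite !big_cons; case: (P i) => //; rewrite hv ?IH //; first exact: rpred_prod.
by elim/big_ind: _ => //; [apply: oner_neq0|apply: mulf_neq0].
Qed.

(** Composing with the norm extends [v] across an algebraic element: on [k] it multiplies [v] by a
    positive degree, so the value at [y] stays nonzero. *)
Lemma homon_adjoin k x (P : {poly K}) v y :
    P \is a polyOver k -> P != 0 -> root P x -> homon k v ->
    y \in k -> y != 0 -> v y != 0 ->
  exists2 v', homon (adjoin k x) v' & v' y != 0.
Proof.
move=> Pk P0 Px hv yk y0 vy; have [d [N [d0 hN NM Nk]]] := norm_exists Pk P0 Px.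
exists (v \o N) => [a b ak bk a0 b0|] /=.
  by rewrite NM // hv //; [case: (hN a)|case: (hN b)|case: (hN a)|case: (hN b)].
by rewrite Nk // (homonX _ hv) // mulrn_eq0 (negbTE vy) orbF -lt0n.
Qed.

Definition transc k (x : K) := forall P, P \is a polyOver k -> root P x -> P = 0.

Lemma transc_neq0 k x : transc k x -> x != 0.
Proof.
move=> tx; apply/eqP => x0; have := tx 'X (polyOverX _).
by rewrite x0 rootX eqxx => /(_ isT)/eqP; rewrite polyX_eq0.
Qed.

(** The order of vanishing at 0 of a rational function in [x]; transcendence makes it independent of
    the fraction chosen. *)
Lemma homon_transc k x : transc k x -> exists2 v, homon (adjoin k x) v & v x = 1.
Proof.
move=> tx.
have fr y : exists P : {poly K} * {poly K}, y \in adjoin k x ->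
    [/\ P.1 \is a polyOver k, P.2 \is a polyOver k, P.2.[x] != 0 & y = P.1.[x] / P.2.[x]].
  have [/adjoinP[P [Q h]]|] := boolP (y \in adjoin k x); last by exists (0, 0).
  by exists (P, Q).
have [f hf] := choice fr.
pose w (P : {poly K}) : int := (mup 0 P)%:Z.
have wM P Q : P != 0 -> Q != 0 -> w (P * Q) = w P + w Q.
  by move=> P0 Q0; rewrite /w mupM // PoszD.
have vE y P Q : y \in adjoin k x -> y != 0 -> P \is a polyOver k -> Q \is a polyOver k ->
    Q.[x] != 0 -> y = P.[x] / Q.[x] -> w (f y).1 - w (f y).2 = w P - w Q.
  move=> yk y0 Pk Qk Q0 yE; have [hP hQ hQ0 yE'] := hf _ yk.
  have P0 : P.[x] != 0 by apply: contraNneq y0 => P0; rewrite yE P0 mul0r.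
  have P'0 : (f y).1.[x] != 0 by apply: contraNneq y0 => P'0; rewrite yE' P'0 mul0r.
  have nz (R : {poly K}) : R.[x] != 0 -> R != 0.
    by apply: contraNneq => ->; rewrite horner0.
  suff E : (f y).1 * Q = P * (f y).2.
    have := congr1 w E; rewrite !wM ?nz //.
    by move: (w P) (w Q) (w _) (w _) => a b c d; clear; lia.
  apply/eqP; rewrite -subr_eq0; apply/eqP/tx; first by rewrite rpredB ?rpredM.
  rewrite rootE hornerD hornerN !hornerM subr_eq0; apply/eqP.
  have /eqP : (f y).1.[x] / (f y).2.[x] = P.[x] / Q.[x] by rewrite -yE' -yE.
  by rewrite eqr_div // => /eqP.
exists (fun y => w (f y).1 - w (f y).2).
  move=> a b ak bk a0 b0; have [h1 h2 h3 h4] := hf _ ak; have [g1 g2 g3 g4] := hf _ bk.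
  have nz (R : {poly K}) : R.[x] != 0 -> R != 0.
    by apply: contraNneq => ->; rewrite horner0.
  have a1 : (f a).1.[x] != 0 by apply: contraNneq a0 => e; rewrite h4 e mul0r.
  have b1 : (f b).1.[x] != 0 by apply: contraNneq b0 => e; rewrite g4 e mul0r.
  rewrite (vE _ ((f a).1 * (f b).1) ((f a).2 * (f b).2)) ?rpredM ?mulf_neq0 //.
  - by rewrite !wM ?nz // opprD addrACA.
  - by rewrite hornerM mulf_neq0.
  - by rewrite {1}h4 {1}g4 !hornerM mulf_div.
have x0 := transc_neq0 tx.
rewrite (vE _ 'X 1) ?adjoin_gen ?polyOverX ?rpred1 ?hornerC ?oner_neq0 //.
  by rewrite /w -['X]expr1 -['X]subr0 mup_XsubCX eqxx mupNroot // rootC oner_neq0.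
by rewrite hornerX divr1.
Qed.

End Homomorphisms.

Section Separation.
Variables (K : fieldType) (p : nat) (hp : p \in [pchar K]).
Implicit Types k : divringClosed K.

(* If [g] is algebraic over [k(x)] and [x] is transcendental over [k(g)] we may
   adjoin [g] first; otherwise [g] is algebraic over the field built from [x]. *)
Lemma homon_fg (s : seq K) k x : transc k x ->
  exists2 v, homon (genf (fun y => [\/ y \in k, y = x | y \in s])) v & v x != 0.
Proof.
elim: s k => [|g s IH] k tx.
  have [v hv vx] := homon_transc tx; exists v; last by rewrite vx.
  apply: homonS hv; apply: genf_min => a [ak|->|//].
  - exact: mem_adjoin.
  - exact: adjoin_gen.
have [tx'|/existsNP[P /not_implyP[Pk /not_implyP[Px P0]]]] := pselect (transc (adjoin k g) x).
  have [v hv vx] := IH _ tx'; exists v => //; apply: homonS hv.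
  apply: genf_min => a [ak|->|]; [| |rewrite inE => /orP[/eqP->|as_]].
  - by apply: sub_genf; constructor 1; apply: mem_adjoin.
  - by apply: sub_genf; constructor 2.
  - by apply: sub_genf; constructor 1; apply: adjoin_gen.
  - by apply: sub_genf; constructor 3.
have [v hv vx] := IH _ tx.
set F := genf (fun y => [\/ y \in k, y = x | y \in s]) in hv.
have kF : {subset k <= F} by move=> a ak; apply: sub_genf; constructor 1.
have xF : x \in F by apply: sub_genf; constructor 2.
suff [Q [Qk Q0 Qg]] : exists Q : {poly K}, [/\ Q \is a polyOver F, Q != 0 & root Q g].
  have x0 := transc_neq0 tx.
  have [v' hv' v'x] := homon_adjoin Qk Q0 Qg hv xF x0 vx.
  exists v' => //; apply: homonS hv'; apply: genf_min => a.
  case=> [ak|->|]; [by apply/mem_adjoin/kF|exact: mem_adjoin|].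
  rewrite inE => /orP[/eqP->|as_]; first exact: adjoin_gen.
  by apply: mem_adjoin; apply: sub_genf; constructor 3.
(* Clearing denominators turns [P.[x] = 0] into a polynomial relation between [x] and [g] over [k],
   read below as a polynomial [Q] in [g] with coefficients in [k[x]]. *)
have hex i : exists AB : {poly K} * {poly K}, [/\ AB.1 \is a polyOver k,
    AB.2 \is a polyOver k, AB.2.[g] != 0 & P`_i = AB.1.[g] / AB.2.[g]].
  by move/polyOverP: Pk => /(_ i)/adjoinP[A [B h]]; exists (A, B).
have [ab hab] := choice hex.
pose n := size P.
pose D := \prod_(i < n) (ab i).2.
pose C (i : 'I_n) := (ab i).1 * \prod_(j < n | j != i) (ab j).2.
have Ck i : C i \is a polyOver k.
  apply: rpredM; first by case: (hab i).
  by apply: rpred_prod => j _; case: (hab j).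
have Dg : D.[g] != 0.
  by rewrite horner_prod; apply/prodf_neq0 => i _; case: (hab i).
have CE i : (C i).[g] = P`_i * D.[g].
  case: (hab i) => _ _ B0 ->; rewrite /D (bigD1 i) //= !hornerM.
  by rewrite mulrA divfK.
pose Q := \sum_(i < n) x ^+ i *: C i.
exists Q; split.
- apply: rpred_sum => i _; apply: polyOverZ; first exact: rpredX.
  by apply/polyOverP => j; apply: kF; move/polyOverP: (Ck i); apply.
- apply/eqP => Q0; apply: P0; apply/eqP; rewrite -lead_coef_eq0 lead_coefE.
  apply/negPn/negP => lP0.
  have n0 : (0 < n)%N.
    by rewrite size_poly_gt0; apply: contraNneq lP0 => ->; rewrite coef0.
  have ln : (n.-1 < n)%N by rewrite prednK.
  have C0 : C (Ordinal ln) != 0.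
    apply: contraNneq lP0 => /(congr1 (horner^~ g)); rewrite CE horner0 => /eqP.
    by rewrite mulf_eq0 (negbTE Dg) orbF.
  (* The coefficient of [Q] in degree [j] is [R.[x]], where [R] has a nonzero top coefficient;
     transcendence of [x] over [k] keeps it from vanishing. *)
  pose j := (size (C (Ordinal ln))).-1.
  pose R := \poly_(i < n) (if insub i is Some i' then (C i')`_j else 0).
  have Rk : R \is a polyOver k.
    apply/polyOverP => i; rewrite coef_poly; case: ifP => _; last exact: rpred0.
    by case: insubP => [i' _ _|_]; [move/polyOverP: (Ck i'); apply|apply: rpred0].
  have Rx : root R x.
    rewrite rootE horner_poly -[X in _ == X](coef0 _ j) -Q0 coef_sum; apply/eqP.
    by apply: eq_bigr => i _; rewrite valK coefZ mulrC.
  have := tx _ Rk Rx => /(congr1 (fun R : {poly K} => R`_n.-1)).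
  rewrite coef0 coef_poly ln insubT => /eqP.
  by rewrite -lead_coefE lead_coef_eq0 (negbTE C0).
- rewrite rootE horner_sum.
  under eq_bigr => i _ do rewrite hornerZ CE mulrA.
  rewrite -mulr_suml [X in X * _](_ : _ = P.[x]).
    by rewrite (rootP Px) mul0r.
  by rewrite horner_coef; apply: eq_bigr => i _; rewrite mulrC.
Qed.

Definition frob_periodic (x : K) := exists2 L, (0 < L)%N & x ^+ (p ^ L) = x.

Lemma frob_period_muln L q (x : K) : x ^+ (p ^ L) = x -> x ^+ (p ^ (L * q)) = x.
Proof.
by move=> xL; elim: q => [|q IH]; rewrite ?muln0 ?expr1 // mulnS expnD exprM xL.
Qed.

Lemma prime_subfield_fixed a : a \in genf (fun _ : K => False) -> a ^+ p = a.
Proof.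
move=> /genfP/(_ [pred y | y ^+ p == y]) h; apply/eqP; apply: h => //.
split=> [|y z|y z]; rewrite !inE ?expr1n //.
  move=> /eqP hy /eqP hz; have := pchar_expD hp 1 y (- z).
  by rewrite (pchar_expN hp) !expn1 hy hz => ->.
by move=> /eqP hy /eqP hz; rewrite exprMn exprVn hy hz.
Qed.

(** If [x] is algebraic over the prime field, its Frobenius iterates are roots of one polynomial, so
    two of them agree; otherwise [homon_fg] applies over the prime field. *)
Lemma frob_periodic_or_homon (s : seq K) x : x \in genf (fun a => a \in s) -> x != 0 ->
  frob_periodic x \/ exists2 v, homon (genf (fun a => a \in s)) v & v x != 0.
Proof.
move=> xK x0; set k := genf (fun _ : K => False).
have [tx|/existsNP[P /not_implyP[Pk /not_implyP[Px /eqP P0]]]] := pselect (transc k x).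
  right; have [v hv vx] := homon_fg s tx; exists v => //; apply: homonS hv.
  by apply: genfS => a as_; constructor 3.
left.
have Pr i : root P (x ^+ (p ^ i)).
  elim: i => [|i IH]; first by rewrite expr1.
  have E y : P.[y] ^+ (p ^ 1) = P.[y ^+ p].
    rewrite !horner_coef (pchar_exp_sum hp) expn1; apply: eq_bigr => j _.
    rewrite exprMn prime_subfield_fixed; last by move/polyOverP: Pk; apply.
    by rewrite exprAC.
  by rewrite rootE expnSr exprM -E (rootP IH) (pchar_exp0 hp).
pose r := [seq x ^+ (p ^ i) | i <- iota 0 (size P)].
have /(uniqPn 0)[i [j [ij js]]] : ~~ uniq r.
  apply: contraTN (leqnn (size P)) => ur; rewrite -ltnNge.
  have := max_poly_roots P0 (rs := r); rewrite size_map size_iota; apply=> //.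
  by apply/allP => _ /mapP[i _ ->].
rewrite size_map size_iota in js.
rewrite !(nth_map 0%N) ?size_iota ?(ltn_trans ij) // !nth_iota ?(ltn_trans ij) // !add0n.
rewrite -(subnK (ltnW ij)) expnD exprM => h.
exists (j - i)%N; first by rewrite subn_gt0.
by apply/esym/(pchar_exp_inj hp (m := i)).
Qed.

End Separation.

Section Monomials.
Variables (K : fieldType) (t : nat).
Implicit Types (w : 'I_t -> K) (a b : 'rV[int]_t).

Definition monv w a := \prod_i w i ^ a 0 i.

Lemma monv_neq0 w a : (forall i, w i != 0) -> monv w a != 0.
Proof. by move=> w0; apply/prodf_neq0 => i _; rewrite expfz_neq0. Qed.

Lemma monv0 w : monv w 0 = 1.
Proof. by rewrite /monv big1 // => i _; rewrite mxE expr0z. Qed.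

Lemma monvD w a b : (forall i, w i != 0) -> monv w (a + b) = monv w a * monv w b.
Proof. by move=> w0; rewrite -big_split; apply: eq_bigr => i _; rewrite mxE expfzDr. Qed.

Lemma monvN w a : monv w (- a) = (monv w a)^-1.
Proof. by rewrite -prodfV; apply: eq_bigr => i _; rewrite mxE invr_expz. Qed.

Lemma monvB w a b : (forall i, w i != 0) -> monv w (a - b) = monv w a / monv w b.
Proof. by move=> w0; rewrite monvD // monvN. Qed.

Lemma monvZ w a z : monv w (z *: a) = monv w a ^ z.
Proof.
rewrite /monv; elim/big_rec2: _ => [|i x y _ ->]; first by rewrite exp1rz.
by rewrite expfzMl exprz_exp mxE [z * _]mulrC.
Qed.

Lemma monv_sum w (I : Type) (s : seq I) (P : pred I) (F : I -> 'rV[int]_t) :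
  (forall i, w i != 0) ->
  monv w (\sum_(i <- s | P i) F i) = \prod_(i <- s | P i) monv w (F i).
Proof.
by move=> w0; apply: (big_morph (monv w)); [move=> a b; apply: monvD|apply: monv0].
Qed.

Lemma monvX w a n : monv (fun i => w i ^+ n) a = monv w a ^+ n.
Proof. by rewrite -prodrXl; apply: eq_bigr => i _; rewrite !exprnP exprzAC. Qed.

Lemma monv_mulf w w' a : monv (fun i => w i * w' i) a = monv w a * monv w' a.
Proof. by rewrite -big_split; apply: eq_bigr => i _; rewrite expfzMl. Qed.

Lemma monv_delta w i : monv w (delta_mx 0 i) = w i.
Proof.
rewrite /monv (bigD1 i) //= mxE !eqxx expr1z big1 ?mulr1 // => j ji.
by rewrite mxE (negbTE ji) andbF expr0z.
Qed.

Lemma rpred_exprz (k : divringClosed K) x z : x \in k -> x ^ z \in k.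
Proof. by move=> xk; case: z => n; rewrite ?NegzE -?exprnN ?rpredV rpredX. Qed.

Lemma monv_rpred (k : divringClosed K) w a : (forall i, w i \in k) -> monv w a \in k.
Proof. by move=> wk; apply: rpred_prod => i _; apply: rpred_exprz. Qed.

End Monomials.

Lemma monv_mulmx (K : fieldType) s t (w : 'I_t -> K) (M : 'M[int]_(s, t)) (b : 'rV_s) :
  (forall i, w i != 0) -> monv w (b *m M) = monv (fun i => monv w (row i M)) b.
Proof.
move=> w0; rewrite mulmx_sum_row monv_sum //.
by apply: eq_bigr => i _; rewrite monvZ.
Qed.

Section LinearProjection.
Variables (K : fieldType) (F : divringClosed K).

(* [q] lists the values at the [d j] of an [F]-linear form on [K] with value 1 at 1. *)
Lemma linear_form_seq l (d : nat -> K) : exists2 q : nat -> K, (forall j, q j \in F) &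
  forall z0 (z : nat -> K), z0 \in F -> (forall j, z j \in F) ->
    z0 + \sum_(j < l) d j * z j = 0 -> z0 + \sum_(j < l) q j * z j = 0.
Proof.
elim: l => [|l [q qF hq]].
  by exists (fun=> 0) => [j|z0 z _ _]; rewrite ?rpred0 ?big_ord0.
have [[y0 [y [y0F yF yE]]]|no] := pselect (exists y0 (y : nat -> K),
    [/\ y0 \in F, forall j, y j \in F & d l + (y0 + \sum_(j < l) d j * y j) = 0]).
- exists (fun j => if j == l then - (y0 + \sum_(j < l) q j * y j) else q j) => [j|z0 z z0F zF].
    by case: eqP; rewrite // rpredN rpredD ?rpred_sum // => i _; rewrite rpredM.
  have sumE (f : nat -> K) : \sum_(j < l) f j * (z j - y j * z l) =
      \sum_(j < l) f j * z j - (\sum_(j < l) f j * y j) * z l.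
    rewrite mulr_suml -sumrB; apply: eq_bigr => j _; ring.
  rewrite !big_ord_recr /= eqxx => zE.
  have {}zE : (z0 - y0 * z l) + \sum_(j < l) d j * (z j - y j * z l) = 0.
    rewrite sumE -[RHS]zE; move/eqP: yE; rewrite addr_eq0 => /eqP ->; ring.
  have z'F : z0 - y0 * z l \in F by rewrite rpredB ?rpredM.
  have z''F j : z j - y j * z l \in F by rewrite rpredB ?rpredM.
  rewrite -[RHS](hq _ (fun j => z j - y j * z l) z'F z''F zE) sumE.
  under [in LHS]eq_bigr => j _ do rewrite ltn_eqF //.
  ring.
(* Here [d l] lies outside the [F]-span of 1 and the earlier [d j], so every relation has [z l = 0]
   and any value at [l] would do. *)
exists (fun j => if j == l then 0 else q j) => [j|z0 z z0F zF].
  by case: eqP; rewrite ?rpred0.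
rewrite !big_ord_recr /= eqxx mul0r addr0.
under [X in _ -> _ + X = 0]eq_bigr => j _ do rewrite ltn_eqF //.
have [->|zl0] := eqVneq (z l) 0; first by rewrite mulr0 addr0; apply: hq.
move=> zE; case: no; exists (z0 / z l), (fun j => z j / z l).
split=> [|j|]; rewrite ?rpred_div //.
have -> : \sum_(j < l) d j * (z j / z l) = (\sum_(j < l) d j * z j) / z l.
  by rewrite mulr_suml; apply: eq_bigr => j _; rewrite mulrA.
by apply: (mulIf zl0); rewrite mul0r -[RHS]zE; field.
Qed.

Lemma linear_form (J : finType) (j0 : J) (d : J -> K) : d j0 = 1 ->
  exists q : J -> K, [/\ forall j, q j \in F, q j0 = 1 &
    forall z : J -> K, (forall j, z j \in F) ->
      \sum_j d j * z j = 0 -> \sum_j q j * z j = 0].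
Proof.
move=> d1; pose e (n : nat) : J := nth j0 (enum J) n.
have eE (f : J -> K) : \sum_(n < #|J|) f (e n) = \sum_j f j.
  rewrite -[RHS]big_enum (big_nth j0) big_mkord -cardE.
  by apply: eq_bigr.
have [q qF hq] := linear_form_seq #|J| (fun n => d (e n)).
have rE (i : 'I_#|J|) : enum_rank (e i) = i.
  by rewrite /e -enum_val_nth enum_valK.
have eK (j : J) : e (enum_rank j) = j by rewrite /e nth_enum_rank.
have hqz z0 (z : J -> K) : z0 \in F -> (forall j, z j \in F) ->
    z0 + \sum_j d j * z j = 0 -> z0 + \sum_j q (enum_rank j) * z j = 0.
  move=> z0F zF h; rewrite -(eE (fun j => q (enum_rank j) * z j)).
  under eq_bigr => i _ do rewrite rE.
  by apply: (hq z0 (fun n => z (e n))) => //; rewrite (eE (fun j => d j * z j)).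
have sum1 (f : J -> K) : \sum_j f j * (j == j0)%:R = f j0.
  rewrite (bigD1 j0) //= eqxx mulr1 big1 ?addr0 // => j /negbTE->.
  by rewrite mulr0.
exists (fun j => q (enum_rank j)); split=> // [|z zF h].
  have := hqz (-1) (fun j => (j == j0)%:R); rewrite !sum1 d1 addNr.
  rewrite rpredN rpred1 => /(_ isT (fun _ => rpred_nat _ _) erefl)/eqP.
  by rewrite addrC subr_eq0 => /eqP.
by have := hqz 0 z (rpred0 _) zF; rewrite !add0r => /(_ h).
Qed.

End LinearProjection.

(** * Frobenius images and p-saturation *)

Section FrobeniusImage.
Variables (K : fieldType) (p : nat).
Implicit Types k : divringClosed K.

Definition frob_image (hp : p \in [pchar K]) k m : {pred K} :=
  [pred x | `[< exists2 y, y \in k & x = y ^+ (p ^ m) >]].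

Variable hp : p \in [pchar K].
Notation F := (frob_image hp).

Lemma frob_imageP k m x : reflect (exists2 y, y \in k & x = y ^+ (p ^ m)) (x \in F k m).
Proof. exact: asboolP. Qed.

Fact frob_image_closed k m : GRing.divring_closed (F k m).
Proof.
split=> [|_ _ /frob_imageP[x xk ->] /frob_imageP[y yk ->]|
    _ _ /frob_imageP[x xk ->] /frob_imageP[y yk ->]]; apply/frob_imageP.
- by exists 1; rewrite ?rpred1 ?expr1n.
- by exists (x - y); rewrite ?rpredB // (pchar_expD hp) (pchar_expN hp).
- by exists (x / y); rewrite ?rpred_div // exprMn exprVn.
Qed.

HB.instance Definition _ k m :=
  GRing.isDivringClosed.Build K (F k m) (frob_image_closed k m).

Lemma frob_image_exp k m j x : x \in k -> (x ^+ (p ^ j) \in F k (m + j)) = (x \in F k m).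
Proof.
move=> xk; apply/frob_imageP/frob_imageP => -[y yk yE]; exists y => //.
  by apply: (pchar_exp_inj hp (m := j)); rewrite /= yE expnD exprM.
by rewrite yE expnD exprM.
Qed.

Lemma frob_image_sub k m : {subset F k m <= k}.
Proof. by move=> _ /frob_imageP[y yk ->]; apply: rpredX. Qed.

Lemma frob_imageS k m n : (m <= n)%N -> {subset F k n <= F k m}.
Proof.
move=> le _ /frob_imageP[y yk ->]; apply/frob_imageP.
by exists (y ^+ (p ^ (n - m))); rewrite ?rpredX // -exprM -expnD subnK.
Qed.

Definition frob_core k (x : K) := forall m, x \in F k m.

Lemma frob_periodic_core k x : x \in k -> frob_periodic p x -> frob_core k x.
Proof.
move=> xk [L L0 xL] m; apply/frob_imageP; exists (x ^+ (p ^ (L * m - m))); first exact: rpredX.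
by rewrite -exprM -expnD subnK ?leq_pmull // frob_period_muln.
Qed.

(* A root of a polynomial of degree [< m] over [k^(p^m)] has inseparability
   degree [< p^m] over it: [x^s] and [x^(p^m)] both lie in that field. *)
Lemma root_frob_image k m x (P : {poly K}) : x \in k ->
  P \is a polyOver (F k m) -> P != 0 -> root P x -> (size P <= m)%N -> x \in F k 1.
Proof.
move=> xk Pk P0 Px szP; have pp := pcharf_prime hp.
have [->|x0] := eqVneq x 0; first exact: rpred0.
have [M [monM Mk Mx szM minM]] := minpoly_over Pk P0 Px.
have hpP : p \in [pchar {poly K}] by rewrite pchar_poly.
have xm : x ^+ (p ^ m) \in F k m by apply/frob_imageP; exists x.
have /dvdp_exp_XsubCP[s _ Ms] : M %| ('X - x%:P) ^+ (p ^ m).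
  rewrite (pchar_expD hpP) (pchar_expN hpP) -polyC_exp; apply: minM.
    by rewrite rpredB ?polyOverC // rpredX ?polyOverX.
  by rewrite rootE hornerD hornerN hornerXn hornerC subrr.
have {}Ms : M = ('X - x%:P) ^+ s.
  by apply/eqP; rewrite -eqp_monic // monic_exp ?monicXsubC.
have szMs : size M = s.+1 by rewrite Ms size_exp_XsubC.
have s0 : (0 < s)%N by rewrite -ltnS -szMs; apply: root_size_gt1 Mx; apply: monic_neq0.
have xs : x ^+ s \in F k m.
  move/polyOverP/(_ 0%N): Mk; rewrite -horner_coef0 Ms horner_exp hornerD hornerN.
  rewrite hornerX hornerC sub0r exprNn => h.
  by rewrite -[x ^+ s]mul1r -(signrMK s 1) mulr1 -mulrA rpredM // rpredX // rpredN rpred1.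
have [km kn Hbez _] := egcdnP (p ^ m) s0.
have xg : x ^+ gcdn s (p ^ m) \in F k m.
  rewrite -[_ ^+ _](mulKf (x := x ^+ (kn * p ^ m))) ?expf_neq0 // -exprD -Hbez mulrC.
  by rewrite rpred_div // mulnC exprM rpredX.
have [c _ gE] : exists2 c, (c <= m)%N & gcdn s (p ^ m) = (p ^ c)%N.
  by apply/(dvdn_pfactor _ _ pp); apply: dvdn_gcdr.
(* Indeed [c < p^c <= s < size P <= m]; so after removing the [p^c]-th power from [x^(p^c)], at
   least one Frobenius is left. *)
have cm : (c < m)%N.
  rewrite (leq_trans (ltn_expl c (prime_gt1 pp))) // -gE.
  by rewrite (leq_trans (dvdn_leq s0 (dvdn_gcdl _ _))) // -ltnS -szMs ltnW // ltnS (leq_trans szM).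
have h : x \in F k (m - c) by rewrite -(frob_image_exp (m - c) c xk) subnK ?(ltnW cm) // -gE.
by apply: frob_imageS h; rewrite subn_gt0.
Qed.

End FrobeniusImage.

(** * Finitely generated multiplicative groups modulo Frobenius powers *)

Section FinitelyGenerated.
Variables (K : fieldType) (p : nat) (hp : p \in [pchar K]).
Variables (r : nat) (g : 'I_r -> K).
Hypothesis g0 : forall i, g i != 0.

Definition K0 := genf (fun a => a \in codom g).
Notation F := (frob_image hp K0).

Lemma g_in_K0 i : g i \in K0.
Proof. by apply: sub_genf; apply: codom_f. Qed.

(** Otherwise some homomorphism to the integers would take a nonzero value at [x], and this value
    would be divisible by every power of [p]. *)
Lemma core_periodic x : x != 0 -> frob_core hp K0 x -> frob_periodic p x.
Proof.
move=> x0 xF; have xK : x \in K0 := frob_image_sub (xF 0%N).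
have [//|[v hv vx]] := frob_periodic_or_homon hp xK x0.
have /frob_imageP[y yK yE] := xF `|v x|%N.
have y0 : y != 0 by apply: contraNneq x0 => y0; rewrite yE y0 (pchar_exp0 hp).
have := ltn_expl `|v x|%N (prime_gt1 (pcharf_prime hp)).
have vE : v x = v y *+ p ^ `|v x| by rewrite {1}yE (homonX _ hv).
move: vE; move: (p ^ _)%N => q vE lt.
have : (q %| `|v x|)%N by apply/dvdnP; exists `|v y|%N; rewrite vE -mulr_natr natz abszM.
move=> dv; have := dvdn_leq _ dv; rewrite absz_gt0 leqNgt lt.
by move=> /(_ vx).
Qed.

(* The [p]-saturation of the group generated by [g] in [K0]. *)
Definition psat (x : K) := x \in K0 /\ exists J e, x ^+ (p ^ J) = monv g e.

Lemma psat_neq0 x : psat x -> x != 0.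
Proof.
case=> _ [J [e xE]]; apply: contra_eq_neq xE => ->.
by rewrite (pchar_exp0 hp) eq_sym monv_neq0.
Qed.

Lemma psat_gen e : psat (monv g e).
Proof. by split; [apply: monv_rpred => i; apply: g_in_K0|exists 0%N, e]. Qed.

Lemma psat_widen x J e J' : x ^+ (p ^ J) = monv g e -> (J <= J')%N ->
  exists e', x ^+ (p ^ J') = monv g e'.
Proof.
move=> xE le; exists ((p ^ (J' - J))%:Z *: e).
by rewrite monvZ -exprnP -xE -exprM -expnD subnKC.
Qed.

Lemma psatM x y : psat x -> psat y -> psat (x * y).
Proof.
case=> xK [J [e xE]] [yK [J' [e' yE]]]; split; first exact: rpredM.
have [e1 E1] := psat_widen xE (leq_maxl J J').
have [e2 E2] := psat_widen yE (leq_maxr J J').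
by exists (maxn J J'), (e1 + e2); rewrite exprMn E1 E2 monvD.
Qed.

Lemma psatV x : psat x -> psat x^-1.
Proof.
case=> xK [J [e xE]]; split; first by rewrite rpredV.
by exists J, (- e); rewrite exprVn xE monvN.
Qed.

Lemma psat1 : psat 1.
Proof. by split; [apply: rpred1|exists 0%N, 0; rewrite monv0 expr1]. Qed.

Lemma psat_exprz x z : psat x -> psat (x ^ z).
Proof.
have h n y : psat y -> psat (y ^+ n).
  by move=> hy; elim: n => [|n IH]; rewrite ?exprS; [apply: psat1|apply: psatM].
by move=> hx; case: z => n; rewrite ?NegzE -?exprnN; [apply: h|apply/psatV/h].
Qed.

Lemma psat_monv t (w : 'I_t -> K) a : (forall i, psat (w i)) -> psat (monv w a).
Proof.
move=> hw; rewrite /monv; elim/big_ind: _ => //; [exact: psat1|exact: psatM|].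
by move=> i _; apply: psat_exprz.
Qed.

Lemma psat_root x m : x \in K0 -> psat (x ^+ (p ^ m)) -> psat x.
Proof.
move=> xK [_ [J [e xE]]]; split=> //.
by exists (m + J)%N, e; rewrite expnD exprM.
Qed.

(* A finite part of the saturation lies in a group generated by [r] elements. *)
Lemma psat_pigeonhole (Q : finType) (h : Q -> K) m :
  (forall i, psat (h i)) -> (p ^ (m * r) < #|Q|)%N ->
  exists i j, i != j /\ h i / h j \in F m.
Proof.
move=> hh ltQ; have pp := pcharf_prime hp.
have [Ji hJ] := choice (fun i => (hh i).2).
pose J := (\max_i Ji i)%N.
have hE i : exists e, h i ^+ (p ^ J) = monv g e.
  by have [e E] := hJ i; apply: psat_widen E _; apply: leq_bigmax.
have [E EE] := choice hE.
(* Exponents of [p^J]-th powers form a subgroup of [Z^r]; the [p^J]-th roots attached to its [r]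
   generators generate a group containing all the [h i]. *)
pose A e := exists2 y, y \in K0 & y ^+ (p ^ J) = monv g e.
have hA : subgroup A.
  split; first by exists 1; rewrite ?rpred1 // expr1n monv0.
  move=> a b [y yK yE] [z zK zE]; exists (y / z); first exact: rpred_div.
  by rewrite exprMn exprVn yE zE monvB.
have [B hB genB] := int_subgroup_fg hA.
have hB' l : exists y, y \in K0 /\ y ^+ (p ^ J) = monv g (row l B).
  by have [y ? ?] := hB l; exists y.
have [y hy] := choice hB'.
have y0 l : y l != 0.
  apply: contra_eq_neq (hy l).2 => ->.
  by rewrite (pchar_exp0 hp) eq_sym monv_neq0.
have AE i : A (E i) by exists (h i); rewrite ?EE //; case: (hh i).
have [c cE] := choice (fun i => genB _ (AE i)).
have hc i : h i = monv y (c i).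
  apply: (pchar_exp_inj hp (m := J)); rewrite /= EE cE monv_mulmx // -monvX.
  by apply: eq_bigr => l _; rewrite -(hy l).2.
have pm0 : (0 < p ^ m)%N by rewrite expn_gt0 prime_gt0.
(* Only exponents modulo [p^m] matter, which leaves [p^(m * r)] classes; [(p ^ m).-1.+1] is [p ^ m]
   in a visibly positive form, as [inord] requires. *)
pose f i : {ffun 'I_r -> 'I_(p ^ m).-1.+1} :=
  [ffun l => inord `|(c i ord0 l %% (p ^ m)%N)%Z|%N].
have /injectivePn[i [j ij fE]] : ~~ injectiveb f.
  apply/negP => /injectiveP/leq_card; rewrite card_ffun !card_ord prednK //.
  by rewrite -expnM leqNgt ltQ.
exists i, j; split=> //.
have cij l : exists q, c i 0 l - c j 0 l = (p ^ m)%:Z * q.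
  move/ffunP/(_ l): fE; rewrite !ffunE => /(congr1 val) /=.
  have rg z : (`|(z %% (p ^ m)%N)%Z| < (p ^ m).-1.+1)%N.
    rewrite prednK // -ltz_nat gez0_abs ?modz_ge0 ?ltz_pmod //.
    by rewrite eqz_nat -lt0n.
  rewrite !inordK ?rg // => e; exists ((c i ord0 l %/ (p ^ m)%N)%Z - (c j ord0 l %/ (p ^ m)%N)%Z).
  have {}e : (c i ord0 l %% (p ^ m)%N)%Z = (c j ord0 l %% (p ^ m)%N)%Z.
    have pos z : (0 <= z %% (p ^ m)%N)%Z by rewrite modz_ge0 // eqz_nat -lt0n.
    by rewrite -[LHS]gez0_abs ?pos // e gez0_abs ?pos.
  rewrite {1}(divz_eq (c i ord0 l) (p ^ m)%N) {1}(divz_eq (c j ord0 l) (p ^ m)%N) e; ring.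
have [q qE] := choice cij.
apply/frob_imageP; exists (monv y (\row_l q l)).
  by apply: monv_rpred => l; case: (hy l).
rewrite !hc -monvB // exprnP -monvZ; congr (monv y _).
by apply/rowP => l; rewrite !mxE qE.
Qed.

(** A Siegel-type argument: there are [N ^ r.+1] monomials with exponents in [[0, N)], so two fall
    in the same class, and their quotient has exponents of absolute value below [N]. *)
Lemma psat_small_relation (w : 'I_r.+1 -> K) m N :
  (forall i, psat (w i)) -> (p ^ (m * r) < N ^ r.+1)%N ->
  exists b : 'rV[int]_r.+1, [/\ b != 0, forall i, (`|b ord0 i| < N)%N & monv w b \in F m].
Proof.
move=> hw ltN; have w0 i : w i != 0 := psat_neq0 (hw i).
pose b (e : {ffun 'I_r.+1 -> 'I_N}) : 'rV[int]_r.+1 := \row_i (e i : nat)%:Z.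
have hb e : psat (monv w (b e)) by apply: psat_monv.
have card : (p ^ (m * r) < #|{ffun 'I_r.+1 -> 'I_N}|)%N by rewrite card_ffun !card_ord.
have [e [e' [ee' h]]] := psat_pigeonhole hb card.
exists (b e - b e'); rewrite monvB //; split=> //.
  apply: contraNneq ee' => /eqP; rewrite subr_eq0 => /eqP be.
  apply/eqP/ffunP => i; apply/val_inj; move/rowP/(_ i): be; rewrite !mxE.
  by case.
move=> i; rewrite !mxE; have := ltn_ord (e i); have := ltn_ord (e' i).
move: (nat_of_ord (e i)) (nat_of_ord (e' i)) => x y; clear; lia.
Qed.

(* If all homomorphisms [K0^* -> Z] of a basis are bounded by [C] on the [c i], a
   [p^m]-th power among the monomials of smaller size is killed by all of them. *)
Lemma small_power_core s (c : 'I_s -> K) :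
  (forall i, c i \in K0) -> (forall i, c i != 0) ->
  exists C : nat, forall m (b : 'rV[int]_s), (forall i, (`|b ord0 i| * C < p ^ m)%N) ->
    monv c b \in F m -> frob_core hp K0 (monv c b).
Proof.
move=> cK c0.
pose A (a : 'rV[int]_s) := exists2 v, homon K0 v & forall i, a 0 i = v (c i).
have hA : subgroup A.
  split; first by exists (fun=> 0) => [a b *|i]; rewrite ?addr0 ?mxE.
  move=> a b [v hv vE] [w hw wE]; exists (fun x => v x - w x).
    by move=> x y *; rewrite hv // hw // opprD addrACA.
  by move=> i; rewrite !mxE vE wE.
have [B hB genB] := int_subgroup_fg hA.
have [v hv] : exists v, forall l, homon K0 (v l) /\ forall i, B l i = v l (c i).
  have hB' l : exists v, homon K0 v /\ forall i, B l i = v (c i).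
    by have [v ? vE] := hB l; exists v; split=> // i; rewrite -vE mxE.
  by have [v hv] := choice hB'; exists v.
have vmon w b : homon K0 w -> w (monv c b) = \sum_i w (c i) *~ b 0 i.
  move=> hw; rewrite /monv (homon_prod _ _ hw) => [|i|i]; last by rewrite expfz_neq0.
    by apply: eq_bigr => i _; rewrite (homonZ _ hw).
  exact: rpred_exprz.
(* The sum bounds every generator [v l] on the [c i]; the successor makes [C] positive, so that it
   cancels in [|v l (monv c b)| * C <= (p^m - 1) * C]. *)
pose C := (\sum_l \sum_i `|B l i|)%N.+1.
exists C => m b hb /frob_imageP[y yK yE].
have cb0 : monv c b != 0 by apply: monv_neq0.
have y0 : y != 0 by apply: contraNneq cb0 => y0; rewrite yE y0 (pchar_exp0 hp).
have cbK : monv c b \in K0 by apply: monv_rpred.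
have vl0 l : v l (monv c b) = 0.
  have [hvl vlE] := hv l.
  have dv : (p ^ m %| `|v l (monv c b)|)%N.
    by rewrite yE (homonX _ hvl) //; apply/dvdnP; exists `|v l y|%N; rewrite -mulr_natr natz abszM.
  apply/eqP; rewrite -absz_eq0; apply: contraTT dv; rewrite -lt0n => pos.
  apply/negP => /(dvdn_leq pos); apply/negP; rewrite -ltnNge.
  have pm0 : (0 < p ^ m)%N by rewrite expn_gt0 prime_gt0 // (pcharf_prime hp).
  rewrite vmon // -(prednK pm0) ltnS -(leq_pmul2r (ltn0Sn (\sum_l \sum_i `|B l i|)%N)) -/C.
  have le1 : (`|(\sum_i v l (c i) *~ b ord0 i)%R| <= \sum_i `|B l i| * `|b ord0 i|)%N.
    apply: (big_ind2 (fun (u : int) x => `|u| <= x)%N) => // [u x u' x'|i _].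
      by clear; lia.
    by rewrite -vlE -mulrzr intz abszM.
  apply: leq_trans (leq_mul le1 (leqnn _)) _; rewrite big_distrl /=.
  apply: (@leq_trans (\sum_i `|B l i| * (p ^ m).-1)%N).
    by apply: leq_sum => i _; rewrite -mulnA leq_mul // -ltnS prednK.
  rewrite -big_distrl /= mulnC leq_mul // leqW //.
  by rewrite [X in (_ <= X)%N](bigD1 l) //= leq_addr.
(* On the [c i], any homomorphism agrees with an integer combination of the [v l]. *)
have v0 w : homon K0 w -> w (monv c b) = 0.
  move=> hw; have [q qE] : exists q, (\row_i w (c i)) = q *m B.
    by apply: genB; exists w => // i; rewrite mxE.
  rewrite vmon //.
  under eq_bigr => i _.
    have -> : w (c i) = \sum_l q 0 l * B l i.
      by have /rowP/(_ i) := qE; rewrite !mxE.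
    rewrite mulrz_suml; over.
  rewrite exchange_big big1 //= => l _.
  have := vl0 l; rewrite vmon; last by case: (hv l).
  move=> vE; rewrite -[RHS](mulr0 (q 0 l)) -[in RHS]vE mulr_sumr.
  by apply: eq_bigr => i _; rewrite -mulrzAr (hv l).2.
apply: frob_periodic_core => //.
have [//|[w hw]] := frob_periodic_or_homon hp cbK cb0.
by rewrite v0 ?eqxx.
Qed.

End FinitelyGenerated.

(** * Relations and algebraic independence modulo an ultrafilter *)

Record ultrafilter (T : Type) (U : (T -> Prop) -> Prop) : Prop := Ultrafilter {
  ultraS : forall A B : T -> Prop, (forall x, A x -> B x) -> U A -> U B;
  ultraI : forall A B : T -> Prop, U A -> U B -> U (fun x => A x /\ B x);
  ultra_ex : forall A : T -> Prop, U A -> exists x, A x;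
  ultra_or : forall A : T -> Prop, U A \/ U (fun x => ~ A x)
}.

(** The complements of small sets form a proper filter, which extends to an ultrafilter. *)
Lemma ultrafilter_exists (T : Type) (small : (T -> Prop) -> Prop) :
    small (fun=> False) ->
    (forall A B : T -> Prop, (forall x, A x -> B x) -> small B -> small A) ->
    (forall A B, small A -> small B -> small (fun x => A x \/ B x)) ->
    ~ small (fun=> True) ->
  exists2 U, ultrafilter U & forall A, small A -> ~ U A.
Proof.
move=> s0 sS sU sT.
pose Fl (A : T -> Prop) := small (fun x => ~ A x).
have hFl : filter.ProperFilter Fl.
  split; first by move=> h; apply: sT; apply: sS h => x _; case.
  split.
  - by apply: sS s0 => x; apply.
  - by move=> A B hA hB; apply: sS (sU _ _ hA hB) => x /not_andP.
  - by move=> A B AB; apply: sS => x nB /AB.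
have [U [hU FU]] := filter.ultraFilterLemma hFl.
have pU := @filter.ultra_proper _ _ hU.
have fU := @filter.filter_filter _ _ pU.
have nU : ~ U (fun=> False) := @filter.filter_not_empty _ _ pU.
exists U; first split.
- by move=> A B AB; apply: (@filter.filterS _ _ fU).
- by move=> A B; apply: (@filter.filterI _ _ fU).
- move=> A UA; apply: contrapT => /forallNP nA; apply: nU.
  by apply: (@filter.filterS _ _ fU _ _ _ UA) => x /nA.
- by move=> A; have := filter.in_ultra_setVsetC A hU.
move=> A sA UA; apply: nU.
have UA' : U (fun x => ~ A x) by apply: FU; apply: sS sA => x /contrapT.
by apply: (@filter.filterS _ _ fU _ _ _ (@filter.filterI _ _ fU _ _ UA UA')) => x [].
Qed.

Section Ultrafilter.
Variables (T : Type) (U : (T -> Prop) -> Prop).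
Hypothesis hU : ultrafilter U.

Lemma ultraT (A : T -> Prop) : (forall x, A x) -> U A.
Proof.
by move=> hA; case: (ultra_or hU A) => // h; apply: (ultraS hU) h.
Qed.

Lemma ultraN (A : T -> Prop) : ~ U A -> U (fun x => ~ A x).
Proof. by move=> nA; case: (ultra_or hU A). Qed.

Lemma ultra_all (Q : finType) (P : Q -> T -> Prop) :
  (forall i, U (P i)) -> U (fun x => forall i, P i x).
Proof.
move=> hP; suff h (s : seq Q) : U (fun x => forall i, i \in s -> P i x).
  by apply: (ultraS hU) (h (enum Q)) => x h' i; apply: h'; rewrite mem_enum.
elim: s => [|i s IH]; first exact: ultraT.
apply: (ultraS hU) (ultraI hU (hP i) IH) => x [hi hs] j.
by rewrite inE => /orP[/eqP->|/hs].
Qed.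

Lemma ultra_pigeonhole (Q : finType) (P : Q -> T -> Prop) :
  U (fun x => exists i, P i x) -> exists i, U (P i).
Proof.
move=> h; apply: contrapT => /forallNP nP.
have h' : U (fun x => forall i, ~ P i x).
  by apply: ultra_all => i; apply: ultraN.
by have [x [[i Pi] nPi]] := ultra_ex hU (ultraI hU h h'); case: (nPi i).
Qed.

Variable K : fieldType.

Definition relation (J : finType) (x : J -> T -> K) (c : J -> K) :=
  U (fun k => \sum_j c j * x j k = 0).

(* A nonzero relation of minimal support is unique up to scaling, hence defined
   over any subfield over which the values are, after rescaling by the [d j]. *)
Lemma minimal_relation (J : finType) (x : J -> T -> K) (c : J -> K) j :
    (forall j k, x j k != 0) -> relation x c -> c j != 0 ->
  exists c' j0 j1, [/\ relation x c', j0 != j1, c' j0 = 1, c' j1 != 0 &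
    forall (F : divringClosed K) (d : J -> K), (forall j, d j != 0) ->
      U (fun k => forall j, x j k / d j \in F) -> forall j, c' j * d j / d j0 \in F].
Proof.
move=> x0 hc cj.
pose ok n := `[< exists c, [/\ relation x c, exists j, c j != 0 & #|[set j | c j != 0]| = n] >].
have ex : exists n, ok n by exists #|[set j | c j != 0]|; apply/asboolP; exists c; split=> //; exists j.
case: (ex_minnP ex) => n /asboolP[{cj hc j}c [hc [j0 cj0] cn]] nmin.
have [j1 j01 cj1] : exists2 j1, j0 != j1 & c j1 != 0.
  apply: contrapT => no; have [k] := ultra_ex hU hc.
  rewrite (bigD1 j0) //= big1 ?addr0 => [/eqP|j jj0].
    by rewrite mulf_eq0 (negbTE cj0) (negbTE (x0 _ _)).
  have [->|cj] := eqVneq (c j) 0; first by rewrite mul0r.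
  by case: no; exists j; rewrite // eq_sym.
pose c' j := c j / c j0.
have c'0 j : (c' j == 0) = (c j == 0) by rewrite mulf_eq0 invr_eq0 (negbTE cj0) orbF.
have hc' : relation x c'.
  apply: (ultraS hU) hc => k ck.
  rewrite -[RHS](mul0r (c j0)^-1) -[in RHS]ck mulr_suml.
  by apply: eq_bigr => j _; rewrite mulrAC.
exists c', j0, j1; split=> //; rewrite ?c'0 //; first by rewrite /c' divff.
move=> F d d0 hd.
pose e j := c' j * d j / d j0.
have e1 : e j0 = 1 by rewrite /e /c' divff // mul1r divff.
have [q [qF q1 hq]] := linear_form F e1.
(* Projecting the coefficients to [F] gives a second relation. The factor [(c j != 0)%:R] keeps its
   support inside that of [c]; both relations have coefficient 1 at [j0], so their difference has
   smaller support and must vanish. *)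
pose q' j := (c j != 0)%:R * q j * (d j0 / d j).
have hq' : relation x q'.
  apply: (ultraS hU) (ultraI hU hd hc') => k [dk ck].
  have hF j : (c j != 0)%:R * (x j k / d j) \in F by rewrite rpredM ?rpred_nat.
  have h : \sum_j e j * ((c j != 0)%:R * (x j k / d j)) = 0.
    rewrite -[RHS](mulr0 (d j0)^-1) -[in RHS]ck mulr_sumr; apply: eq_bigr => j _.
    have [cj|cj] := eqVneq (c j) 0.
      by rewrite mul0r mulr0 (_ : c' j = 0) ?mul0r ?mulr0 //; apply/eqP; rewrite c'0 cj.
    by rewrite /e mul1r; field; rewrite !d0.
  have /(congr1 (fun u => d j0 * u)) := hq _ hF h; rewrite mulr0 mulr_sumr => hs.
  by rewrite -[RHS]hs; apply: eq_bigr => j _; rewrite /q'; field.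
have hdiff : relation x (fun j => c' j - q' j).
  apply: (ultraS hU) (ultraI hU hc' hq') => k [ck qk].
  under eq_bigr => j _ do rewrite mulrBl.
  by rewrite sumrB ck qk subrr.
have eq j : c' j = q' j.
  apply/eqP; rewrite -subr_eq0; apply/negPn/negP => nz.
  have : (n <= #|[set j | (c' j - q' j != 0)%R]|)%N.
    by apply: nmin; apply/asboolP; exists (fun j => c' j - q' j); split=> //; exists j.
  rewrite leqNgt -cn => /negP; apply; apply/proper_card/properP; split.
    apply/subsetP => i; rewrite !inE; apply: contraNneq => ci.
    by rewrite /q' ci eqxx !mul0r subr0 c'0 ci.
  exists j0; rewrite !inE ?cj0 // negbK /q' cj0 q1 !mulr1 divff // /c' divff //.
  by rewrite mul1r subrr.
move=> j; rewrite eq /q'.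
have -> : (c j != 0)%:R * q j * (d j0 / d j) * d j / d j0 = (c j != 0)%:R * q j :> K.
  by field; rewrite !d0.
by rewrite rpredM ?rpred_nat.
Qed.

Definition mono_exp D N (w : 'I_D -> K) (e : {ffun 'I_D -> 'I_N}) := \prod_i w i ^+ e i.

Lemma mono_expE D N (w : 'I_D -> K) (e : {ffun 'I_D -> 'I_N}) :
  mono_exp w e = monv w (\row_i (e i : nat)%:Z).
Proof. by apply: eq_bigr => i _; rewrite mxE. Qed.

(* A polynomial is the family of its coefficients at the exponents below some [N];
   relations are required to hold almost everywhere for [U]. *)
Definition algindep (S : K -> Prop) D (w : 'I_D -> T -> K) :=
  forall N (c : {ffun 'I_D -> 'I_N} -> K), (forall e, S (c e)) ->
    relation (fun e k => mono_exp (w ^~ k) e) c -> forall e, c e = 0.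

(** Since the [w i] are almost everywhere [p^m]-th powers, a minimal relation has coefficients in
    [frob_image hp k m] for every [m], that is, in the core. *)
Lemma algindep_core_up (k : divringClosed K) p (hp : p \in [pchar K]) D (w : 'I_D -> T -> K) :
    (forall i x, w i x != 0) ->
    (forall i m, U (fun x => w i x \in frob_image hp k m)) ->
  algindep (frob_core hp k) w -> algindep (fun=> True) w.
Proof.
move=> w0 hw indw N c _ hc e; apply/eqP/negPn/negP => ce.
have m0 (e' : {ffun 'I_D -> 'I_N}) x : mono_exp (w ^~ x) e' != 0.
  by apply/prodf_neq0 => i _; rewrite expf_neq0.
have [c' [j0 [j1 [hc' _ c'1 _ hF]]]] := minimal_relation m0 hc ce.
have c'F e' : frob_core hp k (c' e').
  move=> m; have := hF (frob_image hp k m) (fun=> 1) (fun=> oner_neq0 _) _ e'.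
  rewrite mulr1 divr1; apply; apply: (ultraS hU) (ultra_all (hw ^~ m)) => x hx j.
  by rewrite divr1; apply: rpred_prod => i _; apply: rpredX.
by have /eqP := indw _ c' c'F hc' j0; rewrite c'1 oner_eq0.
Qed.

(** At a generic point a relation becomes a nonzero polynomial of size at most [N], over the
    [p^N]-th powers, with root [x t]; then [root_frob_image] makes [x t] a [p]-th power. *)
Lemma algindep_cons (k : divringClosed K) p (hp : p \in [pchar K]) D (w : 'I_D -> T -> K)
    (x : T -> K) :
    (forall i m, U (fun t => w i t \in frob_image hp k m)) ->
    (forall t, x t \in k) -> U (fun t => x t \notin frob_image hp k 1) ->
  algindep (frob_core hp k) w ->
  algindep (frob_core hp k) (fun i : 'I_D.+1 => if unlift ord0 i is Some j then w j else x).
Proof.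
move=> hw xk x1 indw N c cF hc e; apply/eqP/negPn/negP => ce.
pose cns (j : 'I_N) (e : {ffun 'I_D -> 'I_N}) : {ffun 'I_D.+1 -> 'I_N} :=
  [ffun i => if unlift ord0 i is Some i' then e i' else j].
pose tl (e : {ffun 'I_D.+1 -> 'I_N}) : {ffun 'I_D -> 'I_N} := [ffun i => e (lift ord0 i)].
have cnsK (e' : {ffun 'I_D.+1 -> 'I_N}) : cns (e' ord0) (tl e') = e'.
  by apply/ffunP => i; rewrite !ffunE; case: unliftP => [j ->|->]; rewrite ?ffunE.
have nz : U (fun t => \sum_e' c (cns (e ord0) e') * mono_exp (w ^~ t) e' != 0).
  apply: (ultraS hU) (ultraN (A := fun t =>
      \sum_e' c (cns (e ord0) e') * mono_exp (w ^~ t) e' = 0) _) => [t /eqP//|h].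
  move/eqP: ce; apply; rewrite -(cnsK e).
  exact: (indw _ (fun e' => c (cns (e ord0) e'))).
have [t [hct [/eqP nzt [xt wt]]]] := ultra_ex hU (ultraI hU hc (ultraI hU nz
  (ultraI hU x1 (ultra_all (hw ^~ N))))).
pose P := \poly_(j < N) (if insub j is Some j' then
  \sum_e' c (cns j' e') * mono_exp (w ^~ t) e' else 0).
have szP : (size P <= N)%N by apply: size_poly.
have Pk : P \is a polyOver (frob_image hp k N).
  apply/polyOverP => j; rewrite coef_poly; case: ifP => _; last exact: rpred0.
  case: insubP => [j' _ _|_]; last exact: rpred0.
  apply: rpred_sum => e' _; apply: rpredM; first exact: cF.
  by apply: rpred_prod => i _; apply: rpredX.
have P0 : P != 0.
  apply/eqP => /(congr1 (fun P : {poly K} => P`_(e ord0))).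
  by rewrite coef0 coef_poly ltn_ord valK.
have Px : root P (x t).
  rewrite rootE horner_poly -[X in _ == X]hct; apply/eqP.
  under eq_bigr => j _ do rewrite valK mulr_suml.
  rewrite pair_big /=.
  rewrite [RHS](reindex (fun je : 'I_N * {ffun 'I_D -> 'I_N} => cns je.1 je.2)) /=.
    apply: eq_bigr => -[j e'] _ /=; rewrite -mulrA; congr (_ * _).
    rewrite /mono_exp big_ord_recl unlift_none ffunE unlift_none mulrC.
    by congr (_ * _); apply: eq_bigr => i _; rewrite liftK ffunE liftK.
  exists (fun e : {ffun 'I_D.+1 -> 'I_N} => (e ord0, tl e)) => [[j e'] _ /=|e' _ /=]; last exact: cnsK.
  congr (_, _); first by rewrite ffunE unlift_none.
  by apply/ffunP => i; rewrite !ffunE liftK.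
by move/negP: xt; apply; apply: root_frob_image Px szP.
Qed.

(** The exponent [m t] varies with the point. But the coefficients have a common Frobenius period
    [L], so their [p^(m t)]-th roots depend only on [m t] modulo [L], which is constant almost
    everywhere. *)
Lemma algindep_frob (k : divringClosed K) p (hp : p \in [pchar K]) D (w w' : 'I_D -> T -> K)
    (m : T -> nat) :
    (forall x, x != 0 -> frob_core hp k x -> frob_periodic p x) ->
    (forall i t, w i t = w' i t ^+ (p ^ m t)) ->
  algindep (frob_core hp k) w' -> algindep (frob_core hp k) w.
Proof.
move=> per wE indw N c cF hc.
have hL e : exists L, (0 < L)%N /\ c e ^+ (p ^ L) = c e.
  have [->|ce] := eqVneq (c e) 0; first by exists 1%N; rewrite (pchar_exp0 hp).
  by have [L ? ?] := per _ ce (cF e); exists L.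
have [Le hLe] := choice hL; pose L := (\prod_e Le e)%N.
have L0 : (0 < L)%N by rewrite prodn_gt0 // => e; case: (hLe e).
have perL e n : c e ^+ (p ^ (L * n)) = c e.
  by rewrite /L (bigD1 e) //= -mulnA frob_period_muln // (hLe e).2.
have [m0 hm0] : exists m0 : 'I_L, U (fun t => m t %% L = m0)%N.
  by apply: ultra_pigeonhole; apply: ultraT => t; exists (Ordinal (ltn_pmod (m t) L0)).
(* The [p^(m t)]-th root of [c e]: [L * m0 - m0] is a nonnegative representative of [- m0] modulo
   [L]. *)
pose c' e := c e ^+ (p ^ (L * m0 - m0)).
have c'0 : forall e, c' e = 0.
  apply: indw => [e j|]; first by apply: rpredX; apply: cF.
  apply: (ultraS hU) (ultraI hU hm0 hc) => t [mt ct].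
  apply: (pchar_exp_inj hp (m := m t)); rewrite /= (pchar_exp0 hp) (pchar_exp_sum hp).
  rewrite -[RHS]ct; apply: eq_bigr => e _; rewrite exprMn -exprM -expnD; congr (_ * _).
    have -> : (L * m0 - m0 + m t = L * (m0 + m t %/ L))%N; last exact: perL.
    rewrite {1}(divn_eq (m t) L) mt mulnDr [(L * (_ %/ _))%N]mulnC.
    by move: (leq_pmull m0 L0); move: (L * m0)%N (_ * L)%N (nat_of_ord m0) => x y z; clear; lia.
  by rewrite -prodrXl; apply: eq_bigr => i _; rewrite wE -!exprM mulnC.
move=> e; have /eqP := c'0 e; rewrite expf_eq0 => /andP[_ /eqP//].
Qed.

End Ultrafilter.

(** * Algebraically independent monomials from multiplicative independence *)

Section IndependentMonomials.
Variables (K : fieldType) (p : nat) (hp : p \in [pchar K]).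
Variables (r : nat) (g : 'I_r -> K).
Hypothesis g0 : forall i, g i != 0.
Variables (T : Type) (U : (T -> Prop) -> Prop).
Hypothesis hU : ultrafilter U.
Notation F := (frob_image hp (K0 g)).
Notation psat := (psat p g).
Notation core := (frob_core hp (K0 g)).

Lemma psat_class (x : T -> K) m : (forall t, psat (x t)) ->
  exists2 d, psat d & U (fun t => x t / d \in F m).
Proof.
move=> hx; apply: contrapT => no.
have hd d : psat d -> U (fun t => ~ x t / d \in F m).
  by move=> hd; apply: (ultraN hU) => h; apply: no; exists d.
(* If no class is taken almost everywhere, some value avoids any given finite set of classes;
   greedily this yields more inequivalent elements than there are classes. *)
have [h [hh1 hh2]] : exists h : nat -> K, (forall i, psat (h i)) /\
    forall i j, (i < j)%N -> (j <= p ^ (m * r))%N -> h j / h i \notin F m.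
  elim: (p ^ _)%N => [|n [h [hh1 hh2]]].
    by exists (fun=> 1); split=> [i|i j ij]; [apply: psat1|rewrite leqn0 => /eqP j0; rewrite j0 in ij].
  have [t ht] := ultra_ex hU (ultra_all hU (fun i : 'I_n.+1 => hd _ (hh1 i))).
  exists (fun i => if i == n.+1 then x t else h i); split=> [i|i j ij].
    by case: eqP.
  rewrite leq_eqVlt => /orP[/eqP jn|jn].
    rewrite jn eqxx ltn_eqF -?jn //; apply/negP.
    by rewrite jn in ij; apply: (ht (Ordinal ij)).
  by rewrite !ltn_eqF ?(ltn_trans ij) //; apply: hh2.
have lt : (p ^ (m * r) < #|'I_(p ^ (m * r)).+1|)%N by rewrite card_ord.
have [i [j [ij hij]]] := psat_pigeonhole hp g0 (fun i : 'I_ _ => hh1 i) lt.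
have [ltij|ltji|/val_inj eij] := ltngtP i j; last by rewrite eij eqxx in ij.
  have /negP[] := hh2 _ _ ltij (ltn_ord j).
  by rewrite -[_ / _]invrK rpredV invf_div.
by have /negP[] := hh2 _ _ ltji (ltn_ord i).
Qed.

(** The constant [d] is a coefficient of a minimal relation and is fixed before [m]; the class
    representatives depend on [m] but serve only to locate that coefficient. *)
Lemma relation_ratio (J : finType) (x : J -> T -> K) (c : J -> K) j :
    (forall j t, psat (x j t)) -> relation U x c -> c j != 0 ->
  exists j0 j1 d, [/\ j0 != j1, d != 0 & forall m, U (fun t => d * (x j1 t / x j0 t) \in F m)].
Proof.
move=> hx hc cj; have x0 j' t := psat_neq0 hp g0 (hx j' t).
have [c' [j0 [j1 [_ j01 _ c'1 hF]]]] := minimal_relation hU x0 hc cj.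
exists j0, j1, (c' j1); split=> // m.
have hcl i : exists d, psat d /\ U (fun t => x i t / d \in F m).
  by have [d ? ?] := psat_class m (hx i); exists d.
have [d hd] := choice hcl.
have d0 i : d i != 0 := psat_neq0 hp g0 (hd i).1.
have hxd := ultra_all hU (fun i => (hd i).2).
have h1 := hF (F m) d d0 hxd j1.
apply: (ultraS hU) hxd => t ht.
have -> : c' j1 * (x j1 t / x j0 t) = c' j1 * d j1 / d j0 * (x j1 t / d j1) / (x j0 t / d j0).
  by field; rewrite !d0 !x0.
by apply: rpred_div (ht j0); apply: rpredM (ht j1).
Qed.

Lemma monv_psat t (y : 'I_t -> T -> K) a : (forall i x, psat (y i x)) ->
  forall x, psat (monv (y ^~ x) a).
Proof. by move=> hy x; apply: psat_monv. Qed.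

Lemma subgroup_infdiv t (y : 'I_t -> T -> K) : (forall i x, psat (y i x)) ->
  subgroup (fun a => forall m, U (fun x => monv (y ^~ x) a \in F m)).
Proof.
move=> hy; split=> [m|a b ha hb m].
  by apply: (ultraT hU) => x; rewrite monv0 rpred1.
apply: (ultraS hU) (ultraI hU (ha m) (hb m)) => x [ax bx].
by rewrite monvB ?rpred_div // => i; exact: (psat_neq0 hp g0 (hy i x)).
Qed.

(** Exponents with no nonzero combination in [A] give independent monomials by [relation_ratio]. And
    [A] cannot contain [r.+1] independent vectors: a small relation among their values at one point
    passes to the constants [d i], where [small_power_core] makes it hold for all [m]. *)
Lemma independent_monomials t D (y : 'I_t -> T -> K) :
    (forall i x, psat (y i x)) -> (D + r <= t)%N ->
    (forall a, (forall m, U (fun x => monv (y ^~ x) a \in F m)) -> a = 0) ->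
  exists M : 'M[int]_(D, t), algindep U (fun=> True) (fun i x => monv (y ^~ x) (row i M)).
Proof.
move=> hy le ind.
have y0 i x : y i x != 0 := psat_neq0 hp g0 (hy i x).
pose A a := exists2 d : K, d != 0 & forall m, U (fun x => d * monv (y ^~ x) a \in F m).
have hA : subgroup A.
  split; first by exists 1 => [|m]; rewrite ?oner_neq0 //; apply: (ultraT hU) => x;
    rewrite monv0 mulr1 rpred1.
  move=> a b [d d0 hd] [e e0 he]; exists (d / e) => [|m]; first by rewrite mulf_neq0 ?invr_neq0.
  apply: (ultraS hU) (ultraI hU (hd m) (he m)) => x [dx ex].
  rewrite monvB //; have -> : d / e * (monv (y ^~ x) a / monv (y ^~ x) b) =
     (d * monv (y ^~ x) a) / (e * monv (y ^~ x) b).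
    by field; rewrite e0 monv_neq0.
  by rewrite rpred_div.
have le' : (D + r.+1 <= t.+1)%N by rewrite addnS ltnS.
have [[M hM]|[M hM indM]] := subgroup_rank hA le' (ltn0Sn r).
  exists M => N c _ hc e; apply/eqP/negPn/negP => ce.
  pose ev (e : {ffun 'I_D -> 'I_N}) : 'rV[int]_D := \row_i (e i : nat)%:Z.
  pose x (e : {ffun 'I_D -> 'I_N}) k := monv (y ^~ k) (ev e *m M).
  have hx : relation U x c.
    apply: (ultraS hU) hc => k ck; rewrite -[RHS]ck; apply: eq_bigr => e' _; congr (_ * _).
    by rewrite /x monv_mulmx // mono_expE.
  have [e0 [e1 [d [e01 d0 hd]]]] :=
    relation_ratio (fun e k => monv_psat (ev e *m M) hy k) hx ce.
  case/negP: e01; apply/eqP/ffunP => i; apply/val_inj.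
  have /rowP/(_ i) : ev e1 - ev e0 = 0.
    apply: hM; exists d => // m; apply: (ultraS hU) (hd m) => k.
    by rewrite mulmxBl monvB.
  by rewrite !mxE => /eqP; rewrite subr_eq0 => /eqP[/esym].
have [d hd] : exists d : 'I_r.+1 -> K, forall i, d i != 0 /\
    forall m, U (fun x => d i * monv (y ^~ x) (row i M) \in F m).
  have hM' i : exists d, d != 0 /\ forall m, U (fun x => d * monv (y ^~ x) (row i M) \in F m).
    by have [d ? ?] := hM i; exists d.
  by have [d hd] := choice hM'; exists d.
have d0 i : d i != 0 by case: (hd i).
have hall m := ultra_all hU (fun i => (hd i).2 m).
have dK i : d i \in K0 g.
  have [x hx] := ultra_ex hU (hall 0%N).
  rewrite -[d i](mulfK (x := monv (y ^~ x) (row i M))); last exact: monv_neq0.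
  by rewrite rpred_div ?(frob_image_sub (hx i)) //; case: (monv_psat (row i M) hy x).
have [C hC] := small_power_core hp dK d0.
(* Chosen so that [p^(m * r) = (p^(C * r))^r.+1 < N^r.+1], while exponents up to [p^(C * r)] satisfy
   [p^(C * r) * C < p^(C * r) * p^C = p^m]. *)
pose m := (C * r.+1)%N; pose N := (p ^ (C * r)).+1.
have p1 := prime_gt1 (pcharf_prime hp).
have ltN : (p ^ (m * r) < N ^ r.+1)%N.
  by rewrite /m mulnAC expnM ltn_exp2r.
have [x hx] := ultra_ex hU (hall m).
have [b [b0 bN wb]] := psat_small_relation hp g0 (fun i => monv_psat (row i M) hy x) ltN.
have db : monv d b \in F m.
  rewrite -[monv d b](mulfK (x := monv (fun i => monv (y ^~ x) (row i M)) b)).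
    by rewrite -monv_mulf rpred_div // monv_rpred.
  by apply: monv_neq0 => i; apply: monv_neq0.
have bC i : (`|b ord0 i| * C < p ^ m)%N.
  have [->|C0] := posnP C; first by rewrite muln0 expn_gt0 (ltnW p1).
  apply: (@leq_ltn_trans (p ^ (C * r) * C)%N); first by rewrite leq_mul2r -ltnS bN orbT.
  by rewrite /m mulnS addnC expnD ltn_pmul2l ?expn_gt0 ?(ltnW p1) // ltn_expl.
have core_db := hC m b bC db.
case/negP: b0; apply/eqP/indM/ind => n.
apply: (ultraS hU) (hall n) => z hz; rewrite monv_mulmx //.
rewrite -[X in X \in _](mulfK (monv_neq0 b d0)) -monv_mulf.
by apply: rpred_div (core_db n); apply: monv_rpred => i; rewrite mulrC; apply: hz.
Qed.

(** The number of functions needed for [D] independent monomials over the core. Passing to one more,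
    [subgroup_rank] splits off either enough functions for the induction or those that
    [independent_monomials] needs. *)
Fixpoint rank_bound D := if D is D'.+1 then (rank_bound D' + (D + r))%N else 1%N.

Lemma rank_bound_gt0 D : (0 < rank_bound D)%N.
Proof. by elim: D => //= D; rewrite addn_gt0 => ->. Qed.

Lemma frob_divide t (z : 'I_t -> K) : (forall i, psat (z i)) ->
  exists mw : nat * ('I_t -> K), [/\ forall i, psat (mw.2 i),
    forall i, z i = mw.2 i ^+ (p ^ mw.1) &
    (exists i, mw.2 i \notin F 1) \/ forall i, core (z i)].
Proof.
move=> hz; have [hc|] := pselect (forall i, core (z i)).
  by exists (0%N, z); split; [|move=> i; rewrite expr1|right].
move=> /existsNP[i /existsNP[m /negP him]].
pose P n := [exists i, z i \notin F n].
have ex : exists n, P n by exists m; apply/existsP; exists i.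
case: (ex_minnP ex) => -[|n] /existsP[i0 hi0] nmin.
  case/negP: hi0; apply/frob_imageP; exists (z i0); last by rewrite expr1.
  by case: (hz i0).
have hw j : exists w, psat w /\ z j = w ^+ (p ^ n).
  have : z j \in F n.
    apply/negPn/negP => nj; suff : (n.+1 <= n)%N by rewrite ltnn.
    by apply: nmin; apply/existsP; exists j.
  case/frob_imageP => w wK zE; exists w; split=> //.
  by apply: (psat_root (m := n)) wK _; rewrite -zE.
have [w hw'] := choice hw; exists (n, w); split=> [j|j|]; [by case: (hw' j)|by case: (hw' j)|].
left; exists i0; apply: contra hi0; have [[wK _] ->] := hw' i0.
by rewrite -[n.+1]add1n frob_image_exp.
Qed.

(* Dividing by a maximal power of Frobenius at each point leaves a function that
   is not a [p]-th power; it is transcendental over the infinitely [p]-divisible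
   ones, while the remaining independent ones are handled by
   [independent_monomials]. *)
Lemma core_independent_monomials D t (z : 'I_t -> T -> K) :
    (forall i x, psat (z i x)) -> (rank_bound D <= t)%N ->
    (forall a, U (fun x => core (monv (z ^~ x) a)) -> a = 0) ->
  exists M : 'M[int]_(D, t), algindep U core (fun i x => monv (z ^~ x) (row i M)).
Proof.
elim: D t z => [|D IH] t z hz le ind.
  exists 0 => N c _ hc e; have [x hx] := ultra_ex hU hc.
  rewrite -[RHS]hx (bigD1 e) //= big1 ?addr0; first by rewrite /mono_exp big_ord0 mulr1.
  by move=> e' /eqP[]; apply/ffunP => -[i i0]; have := i0; rewrite ltn0.
have t0 : (0 < t)%N by apply: leq_trans le; apply: rank_bound_gt0.
have [mw hmw] := choice (fun x => frob_divide (fun i => hz i x)).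
pose m x := (mw x).1; pose z' i x := (mw x).2 i.
have hz' i x : psat (z' i x) by case: (hmw x) => h _ _; apply: h.
have zE i x : z i x = z' i x ^+ (p ^ m x) by case: (hmw x) => _ h _; apply: h.
have z'0 i x : z' i x != 0 := psat_neq0 hp g0 (hz' i x).
(* Were all [z i] in the core almost everywhere, a unit exponent vector would contradict [ind];
   otherwise finitely many indices compete and one wins almost everywhere. *)
have [i0 hi0] : exists i0, U (fun x => z' i0 x \notin F 1).
  apply: (ultra_pigeonhole hU); case: (ultra_or hU (fun x => forall i, core (z i x))) => h.
    pose i := Ordinal t0; have := ind (delta_mx 0 i).
    have /[swap]/[apply]/rowP/(_ i)/eqP : U (fun x => core (monv (z ^~ x) (delta_mx 0 i))).
      by apply: (ultraS hU) h => x hx; rewrite monv_delta.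
    by rewrite !mxE !eqxx oner_eq0.
  by apply: (ultraS hU) h => x hx; case: (hmw x) => _ _ [].
have monE a x : monv (z ^~ x) a = monv (z' ^~ x) a ^+ (p ^ m x).
  by rewrite -monvX; apply: eq_bigr => i _; rewrite zE.
have ind' a : U (fun x => core (monv (z' ^~ x) a)) -> a = 0.
  move=> h; apply: ind; apply: (ultraS hU) h => x hx n.
  by rewrite monE; apply: rpredX; apply: hx.
suff [M hM] : exists M : 'M[int]_(D.+1, t), algindep U core (fun i x => monv (z' ^~ x) (row i M)).
  exists M; apply: (algindep_frob hU _ _ hM (m := m)); last by move=> i x; rewrite monE.
  exact: core_periodic.
have le' : (D.+1 + r + rank_bound D <= t.+1)%N by rewrite addnC ltnW // ltnS.
(* In the first case [independent_monomials] gives all [D.+1] monomials; in the second, induction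
   gives [D] infinitely divisible ones, to which [z' i0] is added. *)
have [[M1 hM1]|[M1 hM1 indM1]] := subgroup_rank (subgroup_infdiv hz') le' (rank_bound_gt0 D).
  have [|||M2 hM2] := independent_monomials (t := D.+1 + r) (D := D.+1)
    (y := fun i x => monv (z' ^~ x) (row i M1)).
  - by move=> i x; apply: monv_psat.
  - by [].
  - move=> a ha; apply: hM1 => n; apply: (ultraS hU) (ha n) => x.
    by rewrite monv_mulmx.
  exists (M2 *m M1) => N c _ hc; apply: hM2 => //; apply: (ultraS hU) hc => x cx.
  rewrite -[RHS]cx; apply: eq_bigr => e _; congr (_ * _); apply: eq_bigr => i _.
  by rewrite row_mul monv_mulmx.
pose y i x := monv (z' ^~ x) (row i M1).
have [|||M2 hM2] := IH _ y.
- by move=> i x; apply: monv_psat.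
- by [].
- move=> a ha; apply/indM1/ind'; apply: (ultraS hU) ha => x.
  by rewrite monv_mulmx.
have hM2' i n : U (fun x => monv (y ^~ x) (row i M2) \in F n).
  have : U (fun x => forall j, y j x \in F n) by apply: (ultra_all hU) => j; apply: hM1.
  by apply: (ultraS hU) => x hx; apply: monv_rpred.
have := algindep_cons hU hM2' (fun x => (hz' i0 x).1) hi0 hM2.
set w := fun i : 'I_D.+1 => _.
pose M : 'M[int]_(D.+1, t) := \matrix_(i < D.+1)
  (if unlift ord0 i is Some j then row j (M2 *m M1) else delta_mx 0 i0).
suff wE : w = fun i x => monv (z' ^~ x) (row i M) by move=> h; exists M; rewrite -wE.
apply/funext => i; apply/funext => x; rewrite /w /M rowK.
case: unliftP => [j _|_]; last by rewrite monv_delta.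
by rewrite row_mul monv_mulmx.
Qed.

End IndependentMonomials.

(** * Groups of functions with values in a finitely generated group *)

Lemma poly_roots_finite (K : fieldType) (P : {poly K}) : P != 0 ->
  exists s : seq K, forall x, root P x -> x \in s.
Proof.
have [n] := ubnP (size P); elim: n P => // n IH P; rewrite ltnS => szP P0.
have [[a Pa]|noroot] := pselect (exists a, root P a); last first.
  by exists [::] => x Px; case: noroot; exists x.
have /factor_theorem[Q PQ] := Pa.
have Q0 : Q != 0 by apply: contraNneq P0 => Q0; rewrite PQ Q0 mul0r.
have [|s hs] := IH Q _ Q0.
  by apply: leq_trans szP; rewrite PQ size_Mmonic ?monicXsubC // size_XsubC addn2.
exists (a :: s) => x; rewrite PQ rootM root_XsubC inE => /orP[/hs ->|->//].
exact: orbT.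
Qed.

Section MultiplicativeRecurrence.
Variables (K : fieldType) (p : nat) (hp : p \in [pchar K]).
Variables (r : nat) (g : 'I_r -> K).
Hypothesis g0 : forall i, g i != 0.
(** In the application [T] indexes the orbit and a set is small if its points lie in a proper closed
    subset of [X]; [Gam_irr] expresses irreducibility and [Gam_dep] the bound on transcendence
    degree. *)
Variables (T : Type) (small : (T -> Prop) -> Prop) (Gam : (T -> K) -> Prop) (D : nat).
Hypothesis small0 : small (fun=> False).
Hypothesis smallS : forall A B : T -> Prop, (forall x, A x -> B x) -> small B -> small A.
Hypothesis smallU : forall A B, small A -> small B -> small (fun x => A x \/ B x).
Hypothesis smallT : ~ small (fun=> True).
Hypothesis Gam_val : forall f, Gam f -> forall x, exists e, f x = monv g e.
Hypothesis Gam_cst : forall e, Gam (fun=> monv g e).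
Hypothesis GamM : forall f h, Gam f -> Gam h -> Gam (fun x => f x * h x).
Hypothesis GamV : forall f, Gam f -> Gam (fun x => (f x)^-1).
Hypothesis Gam_irr : forall f c, Gam f -> small (fun x => f x = c) \/ forall x, f x = c.
Hypothesis Gam_dep : forall w : 'I_D -> T -> K, (forall i, Gam (w i)) ->
  exists N (c : {ffun 'I_D -> 'I_N} -> K) e,
    c e != 0 /\ small (fun x => \sum_e c e * mono_exp (w ^~ x) e != 0).

Notation F := (frob_image hp (K0 g)).
Notation core := (frob_core hp (K0 g)).

Lemma Gam_exprz f z : Gam f -> Gam (fun x => f x ^ z).
Proof.
have h n h : Gam h -> Gam (fun x => h x ^+ n).
  move=> hh; elim: n => [|n IH].
    have -> : (fun x => h x ^+ 0) = (fun=> monv g 0).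
      by apply/funext => x; rewrite monv0.
    exact: Gam_cst.
  have -> : (fun x => h x ^+ n.+1) = (fun x => h x * h x ^+ n).
    by apply/funext => x; rewrite exprS.
  exact: GamM.
by move=> hf; case: z => n; [apply: h|apply/GamV/(h n.+1)].
Qed.

Lemma Gam_monv t (z : 'I_t -> T -> K) a : (forall i, Gam (z i)) ->
  Gam (fun x => monv (z ^~ x) a).
Proof.
move=> hz; rewrite /monv; elim: (index_enum _) => [|i s IH].
  have -> : (fun x => \prod_(i <- [::]) z i x ^ a 0 i) = (fun=> monv g 0).
    by apply/funext => x; rewrite big_nil monv0.
  exact: Gam_cst.
have -> : (fun x => \prod_(j <- i :: s) z j x ^ a 0 j) =
    (fun x => z i x ^ a 0 i * \prod_(j <- s) z j x ^ a 0 j).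
  by apply/funext => x; rewrite big_cons.
by apply: GamM => //; apply: Gam_exprz.
Qed.

Lemma Gam_psat f : Gam f -> forall x, psat p g (f x).
Proof. by move=> hf x; have [e ->] := Gam_val hf x; apply: psat_gen. Qed.

Lemma Gam_neq0 f x : Gam f -> f x != 0.
Proof. by move=> hf; exact: (psat_neq0 hp g0 (Gam_psat hf x)). Qed.

(** The exponents of core monomials form a finitely generated group, so the product of the periods
    of its generators serves all of them. *)
Lemma core_gen_periodic : exists2 L, (0 < L)%N &
  forall e, core (monv g e) -> monv g e ^+ (p ^ L) = monv g e.
Proof.
have hA : subgroup (fun e => core (monv g e)).
  split; first by move=> m; rewrite monv0 rpred1.
  by move=> a b ha hb m; rewrite monvB // rpred_div ?ha ?hb.
have [B hB genB] := int_subgroup_fg hA.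
have [L hL] : exists L, forall l, (0 < L l)%N /\ monv g (row l B) ^+ (p ^ L l) = monv g (row l B).
  have hB' l : exists L, (0 < L)%N /\ monv g (row l B) ^+ (p ^ L) = monv g (row l B).
    have h0 : monv g (row l B) != 0 by apply: monv_neq0.
    by have [L ? ?] := core_periodic h0 (hB l); exists L.
  by have [L hL] := choice hB'; exists L.
exists (\prod_l L l)%N; first by rewrite prodn_gt0 // => l; case: (hL l).
move=> e /genB[c ->]; rewrite monv_mulmx // -monvX; apply: eq_bigr => l _.
congr (_ ^ _); rewrite (bigD1 l) //= frob_period_muln //.
by case: (hL l).
Qed.

Definition cst (f : T -> K) := exists c, forall x, f x = c.

Section WithUltrafilter.
Variable U : (T -> Prop) -> Prop.
Hypothesis hU : ultrafilter U.
Hypothesis smallN : forall A, small A -> ~ U A.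

(** Almost all values are roots of one polynomial, so the ultrafilter singles out one value, which
    [Gam_irr] spreads to every point. *)
Lemma core_cst f : Gam f -> U (fun x => core (f x)) -> cst f.
Proof.
move=> hf hc; have [L L0 hL] := core_gen_periodic.
pose P : {poly K} := 'X^(p ^ L) - 'X.
have P0 : P != 0.
  apply/eqP => /(congr1 (fun P : {poly K} => P`_1)); rewrite coefB coefXn coefX coef0 /=.
  rewrite eq_sym gtn_eqF ?sub0r; first by move/eqP; rewrite oppr_eq0 oner_eq0.
  by rewrite -(expn0 p) ltn_exp2l // prime_gt1 // (pcharf_prime hp).
have [s hs] := poly_roots_finite P0.
have [i hi] : exists i : 'I_(size s), U (fun x => f x = nth 0 s i).
  apply: (ultra_pigeonhole hU); apply: (ultraS hU) hc => x hx.
  have fs : f x \in s.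
    apply: hs; rewrite rootE hornerD hornerN hornerXn hornerX subr_eq0.
    by have [e fE] := Gam_val hf x; rewrite fE hL // -fE.
  have ls : (index (f x) s < size s)%N by rewrite index_mem.
  by exists (Ordinal ls); rewrite /= nth_index.
by case: (Gam_irr (nth 0 s i) hf) => [/smallN//|h]; exists (nth 0 s i).
Qed.

Lemma algindep_false (w : 'I_D -> T -> K) : (forall i, Gam (w i)) ->
  algindep U (fun=> True) w -> False.
Proof.
move=> hw ind; have [N [c [e [ce sm]]]] := Gam_dep hw.
case/eqP: ce; apply: (ind N c) => //.
have := ultraN hU (smallN sm); apply: (ultraS hU) => x.
by move/negP/negPn/eqP.
Qed.

(** With [D + r] functions free of infinite divisibility, or [rank_bound r D] infinitely divisible
    ones, there would be [D] algebraically independent elements of [Gam]. *)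
Lemma dependent_mod_cst t (z : 'I_t -> T -> K) : (forall i, Gam (z i)) ->
    (D + r + rank_bound r D <= t)%N ->
  exists2 a, a != 0 & cst (fun x => monv (z ^~ x) a).
Proof.
move=> hz le; apply: contrapT => no.
have ind a : cst (fun x => monv (z ^~ x) a) -> a = 0.
  by move=> ca; apply/eqP/negPn/negP => a0; case: no; exists a.
have hzp i := Gam_psat (hz i).
have [[M hM]|[M hM indM]] :=
    subgroup_rank (subgroup_infdiv hp g0 hU hzp) (leqW le) (rank_bound_gt0 r D).
  pose y i x := monv (z ^~ x) (row i M).
  have hy i : Gam (y i) by apply: Gam_monv.
  have [|M2 hM2] := independent_monomials (hp := hp) g0 hU (fun i => Gam_psat (hy i)) (leqnn _).
    move=> a ha; apply: hM => m; apply: (ultraS hU) (ha m) => x.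
    by rewrite monv_mulmx // => i; apply: Gam_neq0.
  by apply: algindep_false hM2 => i; apply: Gam_monv.
pose y i x := monv (z ^~ x) (row i M).
have hy i : Gam (y i) by apply: Gam_monv.
have [|M2 hM2] := core_independent_monomials (hp := hp) g0 hU (fun i => Gam_psat (hy i)) (leqnn _).
  move=> a ha; apply/indM/ind/core_cst; first exact: Gam_monv.
  apply: (ultraS hU) ha => x.
  by rewrite monv_mulmx // => i; apply: Gam_neq0.
have hw i : Gam (fun x => monv (y ^~ x) (row i M2)) by apply: Gam_monv.
apply: (algindep_false hw); apply: algindep_core_up hM2 => //.
  by move=> i x; apply: (Gam_neq0 x (hw i)).
move=> i m; have : U (fun x => forall j, y j x \in F m) by apply: (ultra_all hU) => j; apply: hM.
by apply: (ultraS hU) => x hx; apply: monv_rpred.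
Qed.

Definition Gam_hom (psi : (T -> K) -> int) :=
  (forall f h, Gam f -> Gam h -> psi (fun x => f x * h x) = psi f + psi h) /\
  forall f, Gam f -> cst f -> psi f = 0.

Lemma Gam_homV psi f : Gam_hom psi -> Gam f -> psi (fun x => (f x)^-1) = - psi f.
Proof.
move=> [hpsi psi0] hf; apply/eqP; rewrite -addr_eq0 -hpsi //; last exact: GamV.
apply/eqP/psi0; first by apply: GamM => //; apply: GamV.
by exists 1 => x; rewrite mulVf // Gam_neq0.
Qed.

Lemma Gam_hom_exprz psi f z : Gam_hom psi -> Gam f -> psi (fun x => f x ^ z) = psi f *~ z.
Proof.
move=> hpsi hf; have h n : psi (fun x => f x ^+ n) = psi f *+ n.
  elim: n => [|n IH].
    apply: hpsi.2; first exact: (Gam_exprz 0 hf).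
    by exists 1.
  have -> : (fun x => f x ^+ n.+1) = (fun x => f x * f x ^+ n).
    by apply/funext => x; rewrite exprS.
  rewrite hpsi.1 ?IH ?mulrS //; exact: (Gam_exprz n hf).
case: z => n; first exact: h.
rewrite NegzE mulrNz -[psi f *~ _]/(psi f *+ n.+1) -h -Gam_homV //.
exact: (Gam_exprz n.+1 hf).
Qed.

Lemma Gam_hom_monv psi t (z : 'I_t -> T -> K) a : Gam_hom psi -> (forall i, Gam (z i)) ->
  psi (fun x => monv (z ^~ x) a) = \sum_i psi (z i) *~ a 0 i.
Proof.
move=> hpsi hz; rewrite /monv.
suff [] : psi (fun x => \prod_i z i x ^ a 0 i) = \sum_i psi (z i) *~ a 0 i /\
  Gam (fun x => \prod_i z i x ^ a 0 i) by [].
elim: (index_enum _) => [|i s [IH hs]].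
  have E : (fun x => \prod_(i <- [::]) z i x ^ a 0 i) = (fun=> monv g 0).
    by apply/funext => x; rewrite big_nil monv0.
  rewrite E big_nil; split; last exact: Gam_cst.
  by apply: hpsi.2; [apply: Gam_cst|exists (monv g 0)].
have -> : (fun x => \prod_(j <- i :: s) z j x ^ a 0 j) =
    (fun x => z i x ^ a 0 i * \prod_(j <- s) z j x ^ a 0 j).
  by apply/funext => x; rewrite big_cons.
have hi := Gam_exprz (a 0 i) (hz i).
by rewrite big_cons hpsi.1 // IH Gam_hom_exprz //; split=> //; apply: GamM.
Qed.

Lemma subgroup_Gam_hom t (z : 'I_t -> T -> K) : (forall i, Gam (z i)) ->
  subgroup (fun a : 'rV[int]_t => exists2 psi, Gam_hom psi & forall i, a 0 i = psi (z i)).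
Proof.
move=> hz; split; first by exists (fun=> 0) => [|i]; rewrite ?mxE //; split.
move=> a b [psi [hpsi psi0] aE] [psi' [hpsi' psi'0] bE]; exists (fun f => psi f - psi' f).
  split=> [f h hf hh|f hf hc]; last by rewrite psi0 // psi'0 // subrr.
  by rewrite hpsi // hpsi' // opprD addrACA.
by move=> i; rewrite !mxE aE bE.
Qed.

Lemma Gam_hom_eval v x0 x : homon (K0 g) v -> Gam_hom (fun f => v (f x / f x0)).
Proof.
move=> hv; have fK f y : Gam f -> f y \in K0 g by move=> hf; case: (Gam_psat hf y).
have q0 f : Gam f -> f x / f x0 != 0.
  by move=> hf; rewrite mulf_neq0 ?invr_eq0 ?Gam_neq0.
split=> [f h hf hh|f hf [c fc]]; last first.
  by rewrite !fc divff ?(homon1 hv) // -(fc x0) Gam_neq0.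
by rewrite -mulf_div hv ?q0 // rpred_div ?fK.
Qed.

Lemma recurrence_ultra (f : nat -> T -> K) : (forall i, Gam (f i)) ->
  exists d (a : 'rV[int]_d) C, forall x, f d x = C * monv (fun i : 'I_d => f i x) a.
Proof.
move=> hf.
pose indep n := exists2 z : 'I_n -> T -> K, forall i, Gam (z i) &
  forall a, cst (fun x => monv (z ^~ x) a) -> a = 0.
have ex : exists n, `[< indep n >].
  exists 0%N; apply/asboolP; exists (fun=> fun=> monv g 0) => [i|a _]; first exact: Gam_cst.
  by apply/rowP => -[].
have ub n : `[< indep n >] -> (n <= D + r + rank_bound r D)%N.
  move=> /asboolP[z hz indz]; rewrite leqNgt; apply/negP => /ltnW lt.
  have [a a0 ca] := dependent_mod_cst hz lt.
  by rewrite (indz a ca) eqxx in a0.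
case: (ex_maxnP ex ub) => n /asboolP[z hz indz] nmax.
(* By maximality of [n], every element of [Gam] has a nonzero power that is a monomial in [z] up to
   a constant; so a homomorphism to the integers is determined by its values on [z]. *)
have alg h : Gam h -> exists m b, m != 0 /\ cst (fun x => h x ^ m * monv (z ^~ x) b).
  move=> hh; pose y (i : 'I_n.+1) := if unlift ord0 i is Some j then z j else h.
  have hy i : Gam (y i) by rewrite /y; case: (unlift ord0 i).
  have : ~ indep n.+1 by move/asboolP/nmax; rewrite ltnn.
  move=> /forall2NP/(_ y)[//|/existsNP[a /not_implyP[ca a0]]].
  have aE x : monv (y ^~ x) a = h x ^ a 0 ord0 * monv (z ^~ x) (\row_j a 0 (lift ord0 j)).
    rewrite /monv big_ord_recl /y unlift_none; congr (_ * _).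
    by apply: eq_bigr => j _; rewrite liftK mxE.
  exists (a 0 ord0), (\row_j a 0 (lift ord0 j)); split; last first.
    by case: ca => c hc; exists c => x; rewrite -aE hc.
  apply/eqP => a00; apply: a0.
  have /indz/rowP b0 : cst (fun x => monv (z ^~ x) (\row_j a 0 (lift ord0 j))).
    by case: ca => c hc; exists c => x; rewrite -(hc x) aE a00 expr0z mul1r.
  apply/rowP => i; rewrite mxE; case: (unliftP ord0 i) => [j|] -> //.
  by have := b0 j; rewrite !mxE.
have [B hB genB] := int_subgroup_fg (subgroup_Gam_hom hz).
have [psi hpsi] : exists psi, forall l, Gam_hom (psi l) /\ forall i, B l i = psi l (z i).
  have hB' l : exists psi, Gam_hom psi /\ forall i, B l i = psi (z i).
    by have [psi ? psiE] := hB l; exists psi; split=> // i; rewrite -psiE mxE.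
  by have [psi hpsi] := choice hB'; exists psi.
have [d [c hc]] := int_seq_acc (fun i => \row_l psi l (f i)).
pose a : 'rV[int]_d := \row_i c i.
(* The defect of the desired recurrence; the choice of [a] makes every [psi l] vanish on it. *)
pose h x := f d x * monv (fun i : 'I_d => f i x) (- a).
have hfm b : Gam (fun x => monv (fun i : 'I_d => f i x) b) by apply: Gam_monv (fun i => f i) _ _.
have hh : Gam h by apply: GamM.
have psih l : psi l h = 0.
  rewrite (hpsi l).1.1 // (Gam_hom_monv (z := fun i : 'I_d => f i)) //; last by case: (hpsi l).
  have /rowP/(_ l) := hc; rewrite mxE => ->.
  rewrite summxE -big_split big1 //= => i _.
  by rewrite -scaler_int !mxE mulrzl mulrNz subrr.
have [m [b [m0 cm]]] := alg _ hh.
have relpsi psi' : Gam_hom psi' -> psi' h *~ m + \sum_j psi' (z j) *~ b 0 j = 0.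
  move=> hpsi'; rewrite -Gam_hom_exprz // -Gam_hom_monv // -hpsi'.1.
  - by apply: hpsi'.2 => //; apply: GamM; [apply: Gam_exprz|apply: Gam_monv].
  - exact: Gam_exprz.
  - exact: Gam_monv.
have psi'h psi' : Gam_hom psi' -> psi' h = 0.
  move=> hpsi'; have [q qE] : exists q, \row_j psi' (z j) = q *m B.
    by apply: genB; exists psi' => // j; rewrite mxE.
  have := relpsi _ hpsi'; rewrite [X in _ + X](_ : _ = 0).
    by rewrite addr0 => /eqP; rewrite mulrz_eq0 (negbTE m0) => /eqP.
  under eq_bigr => j _.
    have -> : psi' (z j) = \sum_l q 0 l * B l j.
      by have /rowP/(_ j) := qE; rewrite !mxE.
    rewrite mulrz_suml; over.
  rewrite exchange_big big1 //= => l _.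
  have := relpsi _ (hpsi l).1; rewrite psih mul0rz add0r => E.
  rewrite -[RHS](mulr0 (q 0 l)) -[in RHS]E mulr_sumr.
  by apply: eq_bigr => j _; rewrite -mulrzAr (hpsi l).2.
have [x0 _] := ultra_ex hU (ultraT hU (A := fun=> True) (fun=> I)).
have hK x : h x / h x0 \in K0 g.
  by have [h1 _] := Gam_psat hh x; have [h2 _] := Gam_psat hh x0; rewrite rpred_div.
have hq0 x : h x / h x0 != 0 by rewrite mulf_neq0 ?invr_eq0 ?Gam_neq0.
have hq : Gam (fun x => h x / h x0).
  by apply: GamM => //; have [e ->] := Gam_val hh x0; rewrite -monvN; apply: Gam_cst.
(* No homomorphism on [K0] detects these quotients, since evaluating one on them is itself a
   [Gam_hom]; hence they are Frobenius periodic. *)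
have [C hC] : cst (fun x => h x / h x0).
  apply: core_cst => //; apply: (ultraT hU) => x; apply: frob_periodic_core => //.
  have [//|[v hv]] := frob_periodic_or_homon hp (hK x) (hq0 x).
  by rewrite (psi'h _ (Gam_hom_eval x0 x hv)) eqxx.
exists d, a, (C * h x0) => x.
have f0 : monv (fun i : 'I_d => f i x) a != 0 by apply: monv_neq0 => i; apply: Gam_neq0.
by rewrite -(hC x) divfK ?Gam_neq0 // /h monvN divfK.
Qed.

End WithUltrafilter.

Theorem multiplicative_recurrence (f : nat -> T -> K) : (forall i, Gam (f i)) ->
  exists d (a : 'rV[int]_d) C, forall x, f d x = C * monv (fun i : 'I_d => f i x) a.
Proof.
have [U hU smallN] := ultrafilter_exists small0 smallS smallU smallT.
exact: recurrence_ultra hU smallN f.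
Qed.

End MultiplicativeRecurrence.

(** * Forms and monomial maps *)

Section Forms.
Variables (K : fieldType) (n : nat).
Implicit Types P Q : {mpoly K[n.+1]}.

Lemma dhomog_meval_scale (e : nat) P (c : K) (y : 'rV[K]_n.+1) : P \is e.-homog ->
  P.@[(c *: y) ord0] = c ^+ e * P.@[y ord0].
Proof.
move=> hP; rewrite !mevalE mulr_sumr; apply: eq_big_seq => m hm.
have me : mdeg m = e by move/dhomogP: hP => /(_ _ hm).
rewrite mulrCA; congr (_ * _).
under eq_bigr => i _ do rewrite mxE exprMn.
by rewrite big_split /= prodrXr -mdegE me.
Qed.

Lemma dhomog_bigprod (I : Type) (s : seq I) (e : I -> nat) (F : I -> {mpoly K[n.+1]}) :
  (forall i, F i \is (e i).-homog) ->
  \prod_(i <- s) F i \is (\sum_(i <- s) e i)%N.-homog.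
Proof.
by move=> hF; elim/big_rec2: _ => [|i d P _ IH]; [apply: dhomog1|apply: dhomogM].
Qed.

Lemma dhomog_comp m (e d : nat) (P : {mpoly K[m.+1]}) (F : m.+1.-tuple {mpoly K[n.+1]}) :
  P \is d.-homog -> (forall i, tnth F i \is e.-homog) -> P \mPo F \is (e * d).-homog.
Proof.
move=> hP hF; rewrite comp_mpolyEX; rewrite big_seq; apply: rpred_sum => q hq.
have <- : mdeg q = d by move/dhomogP: hP => /(_ _ hq).
apply: dhomogZ; rewrite comp_mpolyX mdegE big_distrr /=.
by apply: dhomog_bigprod => i; apply: dhomogMn.
Qed.

Lemma comp_meval m (P : {mpoly K[m.+1]}) (F : m.+1.-tuple {mpoly K[n.+1]}) (y : 'rV[K]_n.+1) :
  (P \mPo F).@[y ord0] = P.@[(\row_i (tnth F i).@[y ord0]) ord0].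
Proof. by rewrite comp_mpoly_meval; apply: meval_eq => i; rewrite mxE. Qed.

(* A form of degree [d] in [n + 1] variables has at most [(d + 1) ^ n] coefficients. *)
Lemma dhomog_dependent (J : finType) (d : nat) (Q : J -> {mpoly K[n.+1]}) :
    (forall j, Q j \is d.-homog) -> (d.+1 ^ n < #|J|)%N ->
  exists c j0, c j0 != 0 /\ \sum_j c j *: Q j = 0.
Proof.
move=> hQ lt; pose S := {ffun 'I_n -> 'I_d.+1}.
pose mon (q : S) : 'X_{1..n.+1} :=
  [multinom (if unlift ord_max i is Some j then q j : nat else d - \sum_j q j)%N | i < n.+1].
pose A : 'M[K]_(#|J|, #|S|) := \matrix_(i, j) (Q (enum_val i))@_(mon (enum_val j)).
have rk : (\rank A < #|J|)%N.
  by apply: leq_ltn_trans (rank_leq_col _) _; rewrite card_ffun !card_ord.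
have : kermx A != 0 by rewrite -mxrank_eq0 mxrank_ker subn_eq0 -ltnNge.
case/rowV0Pn => v /sub_kermxP vA /rV0Pn[i0 vi0].
exists (fun j => v 0 (enum_rank j)), (enum_val i0); rewrite enum_valK; split=> //.
apply/mpolyP => m; rewrite mcoeff0 raddf_sum /=.
have [md|md] := eqVneq (mdeg m) d; last first.
  by rewrite big1 // => j _; rewrite mcoeffZ (dhomog_nemf_coeff (hQ j)) ?mulr0.
have lem j : (m (lift ord_max j) < d.+1)%N.
  by rewrite ltnS -md mdegE (bigD1 (lift ord_max j)) //= leq_addr.
pose q : S := [ffun j => Ordinal (lem j)].
have mE : m = mon q.
  apply/mnmP => i; rewrite mnmE; case: unliftP => [j ->|->]; first by rewrite ffunE.
  have : (m ord_max + \sum_j q j = d)%N.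
    by rewrite -[RHS]md mdegE (bigD1_ord ord_max) //=; congr addn; apply: eq_bigr => j _;
      rewrite ffunE.
  by move: (m ord_max) (\sum_j _)%N => x y; clear; lia.
have /rowP/(_ (enum_rank q)) := vA; rewrite !mxE => E.
rewrite -[RHS]E [RHS](reindex enum_rank) /=; last by apply: onW_bij; apply: enum_rank_bij.
by apply: eq_bigr => j _; rewrite mcoeffZ mxE !enum_rankK -mE.
Qed.

End Forms.

Section MonomialMaps.
Variables (K : fieldType) (d e : nat) (c : 'I_e -> K) (a : 'M[int]_(e, d)).

Lemma mon_shift_ge i k : (`|mon_exp a i k| <= mon_shift a)%N.
Proof.
by rewrite /mon_shift (bigD1 i) //= (bigD1 k) //= -addnA leq_addr.
Qed.

Lemma mon_shiftE i k :
  (absz ((mon_shift a)%:Z + mon_exp a i k))%:Z = (mon_shift a)%:Z + mon_exp a i k.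
Proof.
rewrite gez0_abs //; have := mon_shift_ge i k.
by move: (mon_exp _ _ _) (mon_shift _) => x y; clear; lia.
Qed.

Lemma mon_exp_sum i : \sum_k mon_exp a i k = 0.
Proof.
rewrite big_ord_recl /mon_exp; case: (unlift ord0 i) => [i'|]; last first.
  by rewrite big1 ?addr0.
rewrite unlift_none addrC; apply/eqP; rewrite subr_eq0; apply/eqP/eq_bigr => j _.
by rewrite liftK.
Qed.

Lemma monmap_homog i : tnth (monmap c a) i \is (d.+1 * mon_shift a).-homog.
Proof.
rewrite tnth_mktuple; apply: dhomogZ.
have -> : (d.+1 * mon_shift a = \sum_k absz ((mon_shift a)%:Z + mon_exp a i k)%R)%N.
  apply/eqP; rewrite -eqz_nat (big_morph Posz PoszD (erefl _)).
  under eq_bigr => k _ do rewrite mon_shiftE.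
  by rewrite big_split /= mon_exp_sum addr0 sumr_const card_ord -mulr_natl natz.
apply: dhomog_bigprod => k; have h : ('X_k : {mpoly K[d.+1]}) \is 1.-homog.
  by rewrite dhomogX; apply/eqP; apply: mdeg1.
have hX m : ('X_k : {mpoly K[d.+1]}) ^+ m \is m.-homog.
  by rewrite -[X in X.-homog]mul1n; apply: dhomogMn.
exact: hX.
Qed.

Lemma monmap_meval (v : 'I_d.+1 -> K) i : v ord0 = 1 -> (forall k, v k != 0) ->
  (tnth (monmap c a) i).@[v] = (\prod_k v k) ^+ mon_shift a *
    (if unlift ord0 i is Some i' then c i' * monv (fun j => v (lift ord0 j)) (row i' a) else 1).
Proof.
move=> v1 v0; rewrite tnth_mktuple mevalZ rmorph_prod /=.
under eq_bigr => k _.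
  rewrite rmorphXn /= mevalXU exprnP mon_shiftE expfzDr // -exprnP; over.
rewrite big_split /= prodrXl mulrCA; congr (_ * _).
rewrite big_ord_recl v1 exp1rz mul1r /mon_exp.
case: (unlift ord0 i) => [i'|]; last by rewrite big1 ?mulr1.
by congr (_ * _); apply: eq_bigr => j _; rewrite liftK mxE.
Qed.

End MonomialMaps.

(** Injectivity of [a] sends distinct monomials of one degree to distinct monomials, so substitution
    into a form produces no cancellation. *)
Lemma monmap_dominant (K : fieldType) d (c : 'I_d -> K) (a : 'M[int]_d) :
    (forall i, c i != 0) -> (forall m : 'rV[int]_d, m *m a = 0 -> m = 0) ->
  dominant (Gm K d) (Gm K d) (monmap c a).
Proof.
move=> c0 inja g /homogP[e hg]; rewrite !inE => /eqP gE.
pose psi (m : 'X_{1..d.+1}) : 'X_{1..d.+1} :=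
  [multinom (\sum_i m i * absz ((mon_shift a)%:Z + mon_exp a i k)%R)%N | k < d.+1].
pose gam (m : 'X_{1..d.+1}) : K :=
  \prod_i (if unlift ord0 i is Some i' then c i' else 1) ^+ m i.
have gam0 m : gam m != 0.
  by apply/prodf_neq0 => i _; rewrite expf_neq0 //; case: (unlift ord0 i) => // *; apply: oner_neq0.
have monE (m : 'X_{1..d.+1}) : \prod_i tnth (monmap c a) i ^+ m i = gam m *: 'X_[psi m].
  under eq_bigr => i _ do rewrite tnth_mktuple exprZn.
  rewrite scaler_prod; congr (_ *: _); rewrite mpolyXE_id.
  under eq_bigr => i _ do rewrite -prodrXl.
  rewrite exchange_big; apply: eq_bigr => k _; rewrite mnmE /= -prodrXr.
  by apply: eq_bigr => i _; rewrite -exprM mulnC.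
have psiE (m : 'X_{1..d.+1}) j : (psi m (lift ord0 j))%:Z =
    (mon_shift a)%:Z * (mdeg m)%:Z + \sum_i (m (lift ord0 i))%:Z * a i j.
  rewrite mnmE (big_morph Posz PoszD (erefl _)).
  under eq_bigr => i _ do rewrite PoszM mon_shiftE mulrDr.
  rewrite big_split /= mdegE (big_morph Posz PoszD (erefl _)) -mulr_suml mulrC.
  congr (_ + _); rewrite big_ord_recl /mon_exp unlift_none mulr0 add0r.
  by apply: eq_bigr => i _; rewrite !liftK.
have psi_inj m m' : mdeg m = mdeg m' -> psi m = psi m' -> m = m'.
  move=> mdE pE.
  pose r : 'rV[int]_d := \row_j ((m (lift ord0 j))%:Z - (m' (lift ord0 j))%:Z).
  have r0 : r = 0.
    apply: inja; apply/rowP => j; rewrite !mxE.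
    under eq_bigr => i _ do rewrite mxE mulrBl.
    rewrite sumrB; have := psiE m j; rewrite pE psiE mdE => /addrI ->.
    by rewrite subrr.
  have lE j : m (lift ord0 j) = m' (lift ord0 j).
    by have /rowP/(_ j) := r0; rewrite !mxE => /eqP; rewrite subr_eq0 => /eqP[].
  apply/mnmP => i; case: (unliftP ord0 i) => [j ->//|->].
  move: mdE; rewrite !mdegE !big_ord_recl /=.
  by rewrite (eq_bigr (fun j => m' (lift ord0 j))) => [/eqP|//]; rewrite eqn_add2r => /eqP.
apply/eqP/mpolyP => m0; rewrite mcoeff0.
have [m0g|] := boolP (m0 \in msupp g); last by move/memN_msupp_eq0.
have := congr1 (mcoeff (psi m0)) gE; rewrite comp_mpolyEX raddf_sum mcoeff0 /=.
under eq_bigr => m _ do rewrite comp_mpolyX monE mcoeffZ mcoeffZ mcoeffX.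
rewrite (bigD1_seq m0) //= eqxx mulr1 big_seq_cond big1 => [|m /andP[mg mm0]].
  by rewrite addr0 => /eqP; rewrite mulf_eq0 (negbTE (gam0 _)) orbF => /eqP.
case: eqP => [pE|]; last by rewrite !mulr0.
case/eqP: mm0; apply: psi_inj pE.
by move/dhomogP: hg => hg; rewrite !hg.
Qed.

(** * Rational maps along an orbit *)

Section RationalMapValues.
Variable K : fieldType.

Definition evalr n m (F : m.+1.-tuple {mpoly K[n.+1]}) (x : 'rV[K]_n.+1) : 'rV[K]_m.+1 :=
  \row_i (tnth F i).@[x ord0].

Lemma evalr_scale n m (F : m.+1.-tuple {mpoly K[n.+1]}) (e : nat) c x :
  (forall i, tnth F i \is e.-homog) -> evalr F (c *: x) = c ^+ e *: evalr F x.
Proof. by move=> hF; apply/rowP => i; rewrite !mxE (dhomog_meval_scale _ _ (hF i)). Qed.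

Lemma colinear m (v w : 'rV[K]_m.+1) : w != 0 ->
  (forall a b, v 0 a * w 0 b = v 0 b * w 0 a) -> exists mu, v = mu *: w.
Proof.
move=> /rV0Pn[b wb] h; exists (v 0 b / w 0 b); apply/rowP => a.
by rewrite mxE mulrAC -h mulfK.
Qed.

(** Transitivity of equality of rational maps: after multiplication by the square of a component of
    [F] outside the prime ideal, the minor is a combination of the given ones. *)
Lemma ratmap_minors n m (X : qpvar K n) (F F' F'' : m.+1.-tuple {mpoly K[n.+1]}) :
    (exists j, tnth F j \notin videal X) -> ratmap_eq X F F' -> ratmap_eq X F F'' ->
  forall a b, tnth F' a * tnth F'' b - tnth F' b * tnth F'' a \in videal X.
Proof.
move=> [j Fj] h' h'' a b.
have := Fj; rewrite -(orbb (_ \in _)) -prime_idealrM => Fjj.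
suff : tnth F j * tnth F j * (tnth F' a * tnth F'' b - tnth F' b * tnth F'' a) \in videal X.
  by rewrite prime_idealrM (negbTE Fjj).
set I := videal X in h' h'' *.
have -> : tnth F j * tnth F j * (tnth F' a * tnth F'' b - tnth F' b * tnth F'' a) =
  - (tnth F j * tnth F'' b) * (tnth F a * tnth F' j - tnth F j * tnth F' a)
  + (tnth F j * tnth F'' a) * (tnth F b * tnth F' j - tnth F j * tnth F' b)
  - (tnth F a * tnth F' j) * (tnth F b * tnth F'' j - tnth F j * tnth F'' b)
  + (tnth F b * tnth F' j) * (tnth F a * tnth F'' j - tnth F j * tnth F'' a) by ring.
by rewrite !(rpredD, rpredN) // idealMr.
Qed.

Lemma on_var_scale n (X : qpvar K n) c x : c != 0 -> on_var X x -> on_var X (c *: x).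
Proof.
move=> c0 [x0 hI [b bX bx]]; split.
- by rewrite scaler_eq0 negb_or c0.
- move=> g gI; have gE := pihomog_partitionE (leqnn (mmeasure mdeg g)).
  rewrite [X in X.@[_]]gE raddf_sum big1 //= => d _.
  have hd : pihomog mdeg d g \is d.-homog by apply: pihomogP.
  by rewrite (dhomog_meval_scale _ _ hd) hI ?mulr0 ?videal_homog.
- exists b => //; have /homogP[d hb] := vbdry_homog bX.
  by rewrite (dhomog_meval_scale _ _ hb) mulf_neq0 ?expf_neq0.
Qed.

(** The scalar [mu] may be 0, when all components of [F'] vanish at [x]; identities between forms
    evaluated at such points remain valid. *)
Lemma rat_at_rep n m (X : qpvar K n) (Y : qpvar K m) F F' x y :
    is_ratmap X Y F -> on_var X x -> rat_at X Y F x y -> ratmap_eq X F F' ->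
  exists mu, evalr F' x = mu *: y.
Proof.
move=> [_ F0 _ _] [_ hI _] [F'' [_ eq'' [v0 _ _] [c c0 yE]]] eq'.
have [mu hmu] : exists mu, evalr F' x = mu *: evalr F'' x.
  apply: colinear v0 _ => a b.
  have /hI := ratmap_minors F0 eq' eq'' a b.
  by rewrite mevalB !mevalM !mxE => /eqP; rewrite subr_eq0 => /eqP.
by exists (mu / c); rewrite yE scalerA divfK.
Qed.

Lemma rat_at_on_var n m (X : qpvar K n) (Y : qpvar K m) F x y :
  rat_at X Y F x y -> on_var Y y.
Proof. by case=> F' [_ _ hv [c c0 ->]]; apply: on_var_scale. Qed.

Lemma rat_at_ex_rep n m (X : qpvar K n) (Y : qpvar K m) F x y :
  rat_at X Y F x y -> exists F' c e, [/\ forall i, tnth F' i \is e.-homog,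
    is_ratmap X Y F', ratmap_eq X F F', c != 0 & evalr F' x = c *: y].
Proof.
case=> F' [rF' eqF' _ [c c0 ->]]; case: (rF') => [[e he] _ _ _].
exists F', c^-1, e; split=> //; first by rewrite invr_eq0.
by rewrite scalerA mulVf // scale1r.
Qed.

Lemma same_pt_refl n (x : 'rV[K]_n.+1) : same_pt x x.
Proof. by exists 1; rewrite ?oner_neq0 ?scale1r. Qed.

Lemma rat_at_unique n m (X : qpvar K n) (Y : qpvar K m) F x x' y y' :
    is_ratmap X Y F -> on_var X x -> same_pt x x' ->
  rat_at X Y F x y -> rat_at X Y F x' y' -> same_pt y y'.
Proof.
move=> rF xX [c c0 ->] h h'.
have [y'0 _ _] := rat_at_on_var h'.
have [F' [d [e [he _ eqF' d0]]]] := rat_at_ex_rep h'.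
have [mu muE] := rat_at_rep rF xX h eqF'.
rewrite (evalr_scale c x he) muE scalerA => yE.
have {}yE : y' = (d^-1 * (c ^+ e * mu)) *: y by rewrite -scalerA yE scalerK.
exists (d^-1 * (c ^+ e * mu)) => //; apply: contraNneq y'0 => z.
by rewrite yE z scale0r.
Qed.

End RationalMapValues.

(** * The companion map of a multiplicative recurrence *)

Section CompanionMatrix.
Variable q : nat.
Implicit Type a : 'rV[int]_q.+1.

Definition companion a : 'M[int]_q.+1 :=
  \matrix_(i, j) if i == ord_max then a 0 j else (j == i.+1 :> nat)%:R.

(** The first column has [a 0 0] as its only nonzero entry, which kills the last coordinate of [m];
    the shift then kills the others. *)
Lemma companion_inj a (m : 'rV[int]_q.+1) : a 0 0 != 0 -> m *m companion a = 0 -> m = 0.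
Proof.
move=> a0 mA.
have mE (j : 'I_q.+1) : \sum_(i < q) m 0 (widen_ord (leqnSn q) i) * (j == i.+1 :> nat)%:R +
    m 0 ord_max * a 0 j = 0.
  have /rowP/(_ j) := mA; rewrite !mxE big_ord_recr /= mxE eqxx => mAj; rewrite -[RHS]mAj.
  congr (_ + _); apply: eq_bigr => i _; rewrite mxE ifN //.
  by rewrite -val_eqE /= ltn_eqF.
have mmax : m 0 ord_max = 0.
  have := mE 0; rewrite big1 => [/eqP|i _]; last by rewrite mulr0.
  by rewrite add0r mulf_eq0 (negbTE a0) orbF => /eqP.
apply/rowP => i; rewrite mxE.
have [iq|] := ltnP i q; last first.
  by move=> qi; rewrite -mmax; congr (m 0 _); apply/val_inj/eqP; rewrite eqn_leq qi -ltnS ltn_ord.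
have lt : (i.+1 < q.+1)%N by [].
have := mE (Ordinal lt); rewrite mmax mul0r addr0 (bigD1 (Ordinal iq)) //= eqxx mulr1.
rewrite big1 ?addr0 => [mi|k].
  by rewrite -[RHS]mi; congr (m 0 _); apply/val_inj.
by rewrite -val_eqE /= eqSS eq_sym => /negbTE->; rewrite mulr0.
Qed.

Lemma monv_companion (K : fieldType) a (w : nat -> K) i :
  monv (fun j : 'I_q.+1 => w j) (row i (companion a)) =
  if i == ord_max then monv (fun j : 'I_q.+1 => w j) a else w i.+1.
Proof.
have [->|imax] := eqVneq i ord_max.
  by apply: eq_bigr => j _; rewrite !mxE eqxx.
have lt : (i.+1 < q.+1)%N.
  by rewrite ltnS ltn_neqAle -ltnS ltn_ord andbT; apply: contraNneq imax => iq; apply/eqP/val_inj.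
rewrite /monv (bigD1 (Ordinal lt)) //= !mxE (negbTE imax) /= eqxx expr1z.
rewrite big1 ?mulr1 // => j; rewrite -val_eqE /= => /negbTE ji.
by rewrite !mxE (negbTE imax) ji expr0z.
Qed.

End CompanionMatrix.

Section TorusMap.
Variables (K : fieldType) (n q : nat).

Implicit Types (N D : 'I_q.+1 -> {mpoly K[n.+1]}) (y : 'rV[K]_n.+1).

(** The map with coordinates [N l / D l], cleared of denominators: the component of index 0 is the
    product of all the [D l]. *)
Definition torus_map (N D : 'I_q.+1 -> {mpoly K[n.+1]}) : q.+2.-tuple {mpoly K[n.+1]} :=
  [tuple \prod_l (if unlift ord0 i == Some l then N l else D l) | i < q.+2].

Definition torus_pt (w : nat -> K) : 'rV[K]_q.+2 :=
  \row_i (if unlift ord0 i is Some j then w j else 1).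

Lemma torus_map_homog N D (e : 'I_q.+1 -> nat) i :
  (forall l, N l \is (e l).-homog) -> (forall l, D l \is (e l).-homog) ->
  tnth (torus_map N D) i \is (\sum_l e l).-homog.
Proof.
by move=> hN hD; rewrite tnth_mktuple; apply: dhomog_bigprod => l; case: ifP.
Qed.

Lemma torus_map_eval N D (w : nat -> K) y :
  (forall l, (N l).@[y ord0] = w l * (D l).@[y ord0]) ->
  evalr (torus_map N D) y = (\prod_l (D l).@[y ord0]) *: torus_pt w.
Proof.
move=> hN; apply/rowP => i; rewrite !mxE tnth_mktuple rmorph_prod /=.
case: (unlift ord0 i) => [j|]; last by rewrite mulr1; apply: eq_bigr.
rewrite (bigD1 j) //= eqxx hN [in RHS](bigD1 j) //= [RHS]mulrC mulrA; congr (_ * _).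
apply: eq_bigr => l lj; rewrite ifN //.
by apply: contra lj => /eqP[->].
Qed.

Lemma torus_pt_monmap e (c' : 'I_e -> K) (a : 'M[int]_(e, q.+1)) (w : nat -> K) i :
  (forall k, w k != 0) ->
  (tnth (monmap c' a) i).@[torus_pt w ord0] = (\prod_k torus_pt w 0 k) ^+ mon_shift a *
    (if unlift ord0 i is Some i' then c' i' * monv (fun j : 'I_q.+1 => w j) (row i' a) else 1).
Proof.
move=> w0; rewrite monmap_meval.
- congr (_ * _); case: (unlift ord0 i) => // i'; congr (_ * _).
  by apply: eq_bigr => j _; rewrite mxE liftK.
- by rewrite mxE unlift_none.
- by move=> k; rewrite mxE; case: (unlift ord0 k) => // *; apply: oner_neq0.
Qed.

Lemma is_ratmap_torus (X : qpvar K n) N D (e : 'I_q.+1 -> nat) y :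
    (forall P, P \in videal X -> P.@[y ord0] = 0) ->
    (forall l, N l \is (e l).-homog) -> (forall l, D l \is (e l).-homog) ->
    (forall l, (N l).@[y ord0] != 0) -> (forall l, (D l).@[y ord0] != 0) ->
  is_ratmap X (Gm K q.+1) (torus_map N D).
Proof.
move=> hI hN hD N0 D0.
have nz i : (tnth (torus_map N D) i).@[y ord0] != 0.
  by rewrite tnth_mktuple rmorph_prod; apply/prodf_neq0 => l _ /=; case: ifP => _.
split.
- by exists (\sum_l e l)%N => i; apply: torus_map_homog.
- by exists ord0; apply/negP => /hI/eqP; rewrite (negbTE (nz _)).
- by move=> P; rewrite inE => /eqP->; rewrite comp_mpoly0 rpred0.
exists (\prod_(i < q.+2) 'X_i); first by rewrite inE.
apply/negP => /hI/eqP; rewrite comp_meval rmorph_prod /=; apply/negP.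
by apply/prodf_neq0 => i _; rewrite mevalXU mxE.
Qed.

Lemma on_var_torus (x : 'rV[K]_q.+2) : (forall i, x 0 i != 0) -> on_var (Gm K q.+1) x.
Proof.
move=> x0; split.
- by apply/rV0Pn; exists ord0.
- by move=> P; rewrite inE => /eqP->; rewrite meval0.
exists (\prod_(i < q.+2) 'X_i); first by rewrite inE.
by rewrite rmorph_prod; apply/prodf_neq0 => i _; rewrite /= mevalXU.
Qed.

End TorusMap.

(** * Rational functions along the orbit and the map to the torus *)

Section Orbit.
Variables (K : fieldType) (n : nat) (X : qpvar K n) (y : nat -> 'rV[K]_n.+1).
Hypothesis yX : forall k, on_var X (y k).
Hypothesis ydense : forall P, P \is homog mdeg ->
  (forall k, P.@[y k ord0] = 0) -> P \in videal X.
Variables (r : nat) (g : 'I_r -> K).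
Hypothesis g0 : forall i, g i != 0.

Lemma videal_eval P k : P \in videal X -> P.@[y k ord0] = 0.
Proof. by case: (yX k) => _ h _; apply: h. Qed.

Lemma dhomog_videal (e : nat) P : P \is e.-homog -> (forall k, P.@[y k ord0] = 0) -> P \in videal X.
Proof. by move=> hP; apply: ydense; apply/homogP; exists e. Qed.

Lemma ratmap_eq_values m (F F' : m.+1.-tuple {mpoly K[n.+1]}) (e e' : nat) :
    (forall i, tnth F i \is e.-homog) -> (forall i, tnth F' i \is e'.-homog) ->
    (forall k, exists a b w, evalr F (y k) = a *: w /\ evalr F' (y k) = b *: w) ->
  ratmap_eq X F F'.
Proof.
move=> hF hF' h i j; apply: (@dhomog_videal (e + e')).
  by rewrite rpredB // dhomogM.
move=> k; have [a [b [w [aE bE]]]] := h k.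
have FE l : (tnth F l).@[y k ord0] = a * w 0 l by have /rowP/(_ l) := aE; rewrite !mxE.
have F'E l : (tnth F' l).@[y k ord0] = b * w 0 l by have /rowP/(_ l) := bE; rewrite !mxE.
by rewrite mevalB !mevalM !FE !F'E; ring.
Qed.

(* [gam] is the sequence of values along the orbit of a rational function that is
   regular at every point of it; the fraction may depend on the point. *)
Definition regular_at (gam : nat -> K) k := exists (e : nat) N D,
  [/\ N \is e.-homog, D \is e.-homog, D.@[y k ord0] != 0 &
    forall l, N.@[y l ord0] = gam l * D.@[y l ord0]].

Definition regular_unit gam := (forall l, exists ex, gam l = monv g ex) /\
  forall k, regular_at gam k.

Definition small (A : nat -> Prop) := exists2 P, P \is homog mdeg &
  P \notin videal X /\ forall k, A k -> P.@[y k ord0] = 0.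

Lemma regular_unit_neq0 gam k : regular_unit gam -> gam k != 0.
Proof. by move=> [h _]; have [e ->] := h k; apply: monv_neq0. Qed.

Lemma small0 : small (fun=> False).
Proof.
exists 1; first by apply/homogP; exists 0%N; apply: dhomog1.
split=> //; apply/negP => /(videal_eval 0); rewrite meval1 => /eqP.
by rewrite oner_eq0.
Qed.

Lemma smallS (A B : nat -> Prop) : (forall k, A k -> B k) -> small B -> small A.
Proof. by move=> AB [P hP [PX PB]]; exists P => //; split=> // k /AB/PB. Qed.

Lemma smallU A B : small A -> small B -> small (fun k => A k \/ B k).
Proof.
move=> [P /homogP[d hP] [PX PA]] [Q /homogP[e hQ] [QX QB]]; exists (P * Q).
  by apply/homogP; exists (d + e)%N; apply: dhomogM.
split; first by rewrite prime_idealrM negb_or PX.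
by move=> k [/PA|/QB] h; rewrite mevalM h ?mul0r ?mulr0.
Qed.

Lemma smallT : ~ small (fun=> True).
Proof. by move=> [P hP [/negP PX h]]; apply/PX/ydense => // k; apply: h. Qed.

Lemma regular_unit_cst e : regular_unit (fun=> monv g e).
Proof.
split=> [_|k]; first by exists e.
exists 0%N, (monv g e)%:MP, 1; rewrite meval1 oner_neq0.
split=> // [||l]; [by rewrite -[_%:MP]mulr1 mul_mpolyC dhomogZ ?dhomog1|exact: dhomog1|].
by rewrite mevalC meval1 mulr1.
Qed.

Lemma regular_unitM a b : regular_unit a -> regular_unit b ->
  regular_unit (fun k => a k * b k).
Proof.
move=> [ha ra] [hb rb]; split=> k.
  by have [e ->] := ha k; have [e' ->] := hb k; exists (e + e'); rewrite monvD.
have [e [N [D [hN hD D0 E]]]] := ra k; have [e' [N' [D' [hN' hD' D'0 E']]]] := rb k.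
exists (e + e')%N, (N * N'), (D * D'); rewrite mevalM mulf_neq0 //.
split=> // [||l]; [exact: dhomogM|exact: dhomogM|].
by rewrite !mevalM E E'; ring.
Qed.

Lemma regular_unitV a : regular_unit a -> regular_unit (fun k => (a k)^-1).
Proof.
move=> ra; have a0 k := regular_unit_neq0 k ra; case: ra => ha ra; split=> k.
  by have [e ->] := ha k; exists (- e); rewrite monvN.
have [e [N [D [hN hD D0 E]]]] := ra k; exists e, D, N.
by rewrite E mulf_neq0 //; split=> // l; rewrite E mulKf.
Qed.

(** If [N - c *: D] vanishes on [X], so does [N' - c *: D'] for the fraction regular at any other
    orbit point, because the ideal is prime and [D] is not in it. *)
Lemma regular_unit_irr a c : regular_unit a ->
  small (fun k => a k = c) \/ forall k, a k = c.
Proof.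
move=> [_ ra]; have [e [N [D [hN hD D0 E]]]] := ra 0%N.
have hP : N - c *: D \is e.-homog by rewrite rpredB ?dhomogZ.
have [PX|PX] := boolP (N - c *: D \in videal X); last first.
  left; exists (N - c *: D); first by apply/homogP; exists e.
  by split=> // k ak; rewrite mevalB mevalZ E ak subrr.
right=> k; have [e' [N' [D' [hN' hD' D'0 E']]]] := ra k.
have : (N' - c *: D') * D \in videal X.
  apply: (@dhomog_videal (e' + e)); first by rewrite dhomogM ?rpredB ?dhomogZ.
  move=> l; have /(videal_eval l) := PX.
  rewrite mevalM !mevalB !mevalZ E E' -!mulrBl => h.
  by rewrite mulrAC h mul0r.
rewrite prime_idealrM => /orP[|] /videal_eval h; last first.
  by have := D0; rewrite h eqxx.
have := h k; rewrite mevalB mevalZ E' -mulrBl => /eqP.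
by rewrite mulf_eq0 (negbTE D'0) orbF subr_eq0 => /eqP.
Qed.

Lemma regular_unit_dependent (w : 'I_n.+1 -> nat -> K) : (forall i, regular_unit (w i)) ->
  exists N (c : {ffun 'I_n.+1 -> 'I_N} -> K) e,
    c e != 0 /\ small (fun k => \sum_e c e * mono_exp (w ^~ k) e != 0).
Proof.
move=> hw; have hw' i : exists t : nat * ({mpoly K[n.+1]} * {mpoly K[n.+1]}),
    [/\ t.2.1 \is t.1.-homog, t.2.2 \is t.1.-homog, t.2.2.@[y 0 ord0] != 0 &
      forall l, t.2.1.@[y l ord0] = w i l * t.2.2.@[y l ord0]].
  by have [_ /(_ 0%N)[e [N [D h]]]] := hw i; exists (e, (N, D)).
have [t ht] := choice hw'.
pose E := (\sum_i (t i).1)%N; pose D := \prod_i (t i).2.2.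
pose P i := \prod_j (if j == i then (t j).2.1 else (t j).2.2).
have hD : D \is E.-homog by apply: dhomog_bigprod => i; case: (ht i).
have hP i : P i \is E.-homog.
  by apply: dhomog_bigprod => j; case: (ht j) => ? ? _ _; case: ifP.
have D0 : D.@[y 0 ord0] != 0.
  by rewrite rmorph_prod; apply/prodf_neq0 => i _; case: (ht i).
have PE i l : (P i).@[y l ord0] = w i l * D.@[y l ord0].
  rewrite !rmorph_prod /= (bigD1 i) //= eqxx [in RHS](bigD1 i) //=.
  have [_ _ _ ->] := ht i; rewrite -mulrA; congr (_ * (_ * _)).
  by apply: eq_bigr => j /negbTE->.
(* There are [M^n.+1] monomials, brought to the common degree [E * M'] by powers of [D]. As
   [E * M' + 1 <= C * M] and [C^n < M], they outnumber the bound [(C * M)^n] on the coefficients. *)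
pose C := (E * n.+1).+1; pose M := (C ^ n).+1; pose M' := (n.+1 * M)%N.
have szM (e : {ffun 'I_n.+1 -> 'I_M}) : (\sum_i e i <= M')%N.
  apply: (@leq_trans (\sum_(i < n.+1) M)%N); first by apply: leq_sum => i _; apply: ltnW.
  by rewrite sum_nat_const card_ord.
pose Q (e : {ffun 'I_n.+1 -> 'I_M}) := D ^+ (M' - \sum_i e i) * \prod_i P i ^+ e i.
have hQ e : Q e \is (E * M').-homog.
  have -> : (E * M' = E * (M' - \sum_i e i) + \sum_i E * e i)%N.
    by rewrite -big_distrr /= -mulnDr subnK.
  by apply: dhomogM; [apply: dhomogMn|apply: dhomog_bigprod => i; apply: dhomogMn].
have lt : ((E * M').+1 ^ n < #|{ffun 'I_n.+1 -> 'I_M}|)%N.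
  rewrite card_ffun !card_ord; apply: (@leq_ltn_trans ((C * M) ^ n)%N).
    have leX a b m : (a <= b)%N -> (a ^ m <= b ^ m)%N.
      by move=> ab; elim: m => // m IH; rewrite !expnS leq_mul.
    by apply: leX; rewrite /M' mulnA /C mulSn addnC -addn1 leq_add2l.
  by rewrite expnMn expnS ltn_pmul2r ?expn_gt0.
have [c [e [ce cQ]]] := dhomog_dependent hQ lt.
exists M, c, e; split=> //; exists D; first by apply/homogP; exists E.
split; first by apply/negP => /(videal_eval 0) h; rewrite h eqxx in D0.
move=> k; apply: contra_neq_eq => Dk.
have := congr1 (meval (y k ord0)) cQ; rewrite meval0 raddf_sum /= => h.
move: PE Dk; set z := D.@[y k ord0] => PE Dk.
have DE m : (D ^+ m).@[y k ord0] = z ^+ m by rewrite rmorphXn.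
have QE e' : (Q e').@[y k ord0] = z ^+ M' * mono_exp (w ^~ k) e'.
  rewrite mevalM DE rmorph_prod /= -[in RHS](subnK (szM e')) exprD -mulrA.
  congr (_ * _); rewrite /mono_exp -prodrXr -big_split; apply: eq_bigr => i _ /=.
  by rewrite rmorphXn /= PE exprMn mulrC.
apply/eqP; rewrite -(mulrI_eq0 _ (mulfI (expf_neq0 M' Dk))); apply/eqP.
rewrite -[RHS]h mulr_sumr; apply: eq_bigr => e' _.
by rewrite mevalZ QE mulrCA.
Qed.

Variables (phi : n.+1.-tuple {mpoly K[n.+1]}).
Hypothesis phi_rat : is_ratmap X X phi.
Hypothesis yS : forall k, rat_at X X phi (y k) (y k.+1).

(** Pull the fraction back along a representative of [phi] valid at [y k]; elsewhere that
    representative may vanish, but the identity is homogeneous and survives scaling by 0. *)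
Lemma regular_unit_shift a : regular_unit a -> regular_unit (fun k => a k.+1).
Proof.
move=> [ha ra]; split=> k; first exact: ha.
have [e [N [D [hN hD D0 E]]]] := ra k.+1.
have [F [c [d [hF _ eqF c0 FE]]]] := rat_at_ex_rep (yS k).
exists (d * e)%N, (N \mPo F), (D \mPo F); split.
- exact: dhomog_comp.
- exact: dhomog_comp.
- by rewrite comp_meval -/(evalr F (y k)) FE (dhomog_meval_scale _ _ hD) mulf_neq0 ?expf_neq0.
move=> l; rewrite !comp_meval -/(evalr F (y l)).
have [mu ->] := rat_at_rep phi_rat (yX l) (yS l) eqF.
by rewrite (dhomog_meval_scale _ _ hN) (dhomog_meval_scale _ _ hD) E mulrCA.
Qed.

Variables (f : 2.-tuple {mpoly K[n.+1]}) (u : nat -> K).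
Hypothesis f_rat : is_ratmap X (Pspace K 1) f.
Hypothesis yf : forall k, rat_at X (Pspace K 1) f (y k) (P1pt (u k)).
Hypothesis u_val : forall k, exists e, u k = monv g e.

Lemma regular_unit_u : regular_unit u.
Proof.
split=> // k; have [F [c [d [hF _ eqF c0 FE]]]] := rat_at_ex_rep (yf k).
exists d, (tnth F ord_max), (tnth F ord0); split=> //.
  by have /rowP/(_ ord0) := FE; rewrite !mxE eqxx mulr1 => ->.
move=> l; have [mu FlE] := rat_at_rep f_rat (yX l) (yf l) eqF.
have /rowP/(_ ord0) := FlE; have /rowP/(_ ord_max) := FlE; rewrite !mxE eqxx mulr1.
by rewrite (_ : (ord_max == ord0 :> 'I_2) = false) // => -> ->; rewrite mulrC.
Qed.

Lemma regular_unit_iter i : regular_unit (fun k => u (k + i)%N).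
Proof.
elim: i => [|i IH].
  have -> : (fun k => u (k + 0)%N) = u by apply/funext => k; rewrite addn0.
  exact: regular_unit_u.
have -> : (fun k => u (k + i.+1)%N) = (fun k => u (k.+1 + i)%N).
  by apply/funext => k; rewrite addSnnS.
exact: regular_unit_shift IH.
Qed.

Hypothesis phi_dom : dominant X X phi.
Variables (p : nat) (hp : p \in [pchar K]).

Lemma u_neq0 k : u k != 0.
Proof. by have [e ->] := u_val k; apply: monv_neq0. Qed.

(* The leading exponent of a recurrence of minimal length is nonzero: otherwise
   it holds for the shifted orbit with one term less, hence for the orbit itself,
   as [phi] is dominant. *)
Lemma orbit_recurrence : exists q (a : 'rV[int]_q.+1) C,
  a 0 0 != 0 /\ forall k, u (k + q.+1)%N = C * monv (fun j : 'I_q.+1 => u (k + j)%N) a.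
Proof.
pose P d := `[< exists (a : 'rV[int]_d) C,
  forall k, u (k + d)%N = C * monv (fun j : 'I_d => u (k + j)%N) a >].
have ex : exists d, P d.
  have [d h] := multiplicative_recurrence (Gam := regular_unit) (small := small) (D := n.+1)
    hp g0 small0 smallS smallU smallT (fun _ h => h.1) regular_unit_cst regular_unitM
    regular_unitV regular_unit_irr regular_unit_dependent regular_unit_iter.
  by exists d; apply/asboolP.
case: (ex_minnP ex) => -[|d] /asboolP[a [C rec]] dmin.
  (* A recurrence of length 0 says that [u] is constant; it is rewritten as [u k.+1 = u k] to have a
     leading exponent. *)
  exists 0%N, (const_mx 1), 1; rewrite mxE; split=> // k.
  rewrite mul1r /monv big_ord_recl big_ord0 mulr1 mxE expr1z.
  by have := rec k; have := rec k.+1; rewrite /monv !big_ord0 !addn0 addn1 => -> ->.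
exists d, a, C; split=> //; apply/eqP => a0.
pose b : 'rV[int]_d := \row_j a 0 (lift ord0 j).
pose h k := u (k + d)%N * monv (fun j : 'I_d => u (k + j)%N) (- b).
have hreg : regular_unit h.
  apply: regular_unitM; first exact: regular_unit_iter.
  apply: (Gam_monv (g := g) regular_unit_cst regular_unitM regular_unitV
    (z := fun (j : 'I_d) k => u (k + j)%N)) => j.
  exact: regular_unit_iter.
have hS k : h k.+1 = C.
  rewrite /h addSnnS rec /monv big_ord_recl a0 expr0z mul1r -mulrA -big_split big1 ?mulr1 // => j _ /=.
  rewrite !mxE /= /bump add1n addSnnS -expfzDr ?subrr ?expr0z //.
  exact: u_neq0.
case: (regular_unit_irr C hreg) => [[Q hQ [QX Qh]]|hC].
  (* [Q] vanishes at every [y k.+1], so its composite with [phi] vanishes on the whole dense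
     orbit. *)
  move/negP: QX; apply; apply: phi_dom => //.
  have [[e he] _ _ _] := phi_rat; have /homogP[d' hd'] := hQ.
  apply: dhomog_videal; first exact: dhomog_comp hd' he.
  move=> k; rewrite comp_meval -/(evalr phi (y k)).
  have [mu ->] : exists mu, evalr phi (y k) = mu *: y k.+1.
    by apply: rat_at_rep phi_rat (yX k) (yS k) _ => i j; rewrite mulrC subrr rpred0.
  by rewrite (dhomog_meval_scale _ _ hd') Qh ?mulr0.
suff /dmin : P d by rewrite ltnn.
apply/asboolP; exists b, C => k; rewrite -(hC k) /h monvN divfK //.
by apply: monv_neq0 => j; apply: u_neq0.
Qed.

Lemma orbit_torus : exists (d : nat) (Th : d.+1.-tuple {mpoly K[n.+1]})
    (c : 'I_d -> K) (a : 'M[int]_d),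
  [/\ is_ratmap X (Gm K d) Th,
      (forall i, c i != 0) /\ dominant (Gm K d) (Gm K d) (monmap c a),
      ratmap_eq X (rcomp Th phi) (rcomp (monmap c a) Th),
      forall k z, same_pt (y k) z -> defined_at X (Gm K d) Th z &
      exists i : 'rV[int]_d, ratmap_eq X f (rcomp (monmap (fun _ : 'I_1 => 1) i) Th)].
Proof.
have [q [a [C [a0 rec]]]] := orbit_recurrence.
have C0 : C != 0 by apply: contraNneq (u_neq0 (0 + q.+1)) => C0; rewrite rec C0 mul0r.
have hex (ik : 'I_q.+1 * nat) : exists t : nat * ({mpoly K[n.+1]} * {mpoly K[n.+1]}),
    [/\ t.2.1 \is t.1.-homog, t.2.2 \is t.1.-homog, t.2.2.@[y ik.2 ord0] != 0 &
      forall l, t.2.1.@[y l ord0] = u (l + ik.1)%N * t.2.2.@[y l ord0]].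
  have [_ /(_ ik.2)[e [N [D h]]]] := regular_unit_iter ik.1.
  by exists (e, (N, D)).
have [t ht] := choice hex.
pose N k i := (t (i, k)).2.1; pose D k i := (t (i, k)).2.2; pose e k i := (t (i, k)).1.
have hN k i : N k i \is (e k i).-homog by case: (ht (i, k)).
have hD k i : D k i \is (e k i).-homog by case: (ht (i, k)).
have D0 k i : (D k i).@[y k ord0] != 0 by case: (ht (i, k)).
have NE k i l : (N k i).@[y l ord0] = u (l + i)%N * (D k i).@[y l ord0].
  by case: (ht (i, k)) => _ _ _ ->.
pose Th k := torus_map (N k) (D k).
pose pt l := torus_pt q (fun j => u (l + j)%N).
have Th_hom k i : tnth (Th k) i \is (\sum_l e k l)%N.-homog by apply: torus_map_homog.
have ThE k l : evalr (Th k) (y l) = (\prod_i (D k i).@[y l ord0]) *: pt l.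
  exact: torus_map_eval.
have Th_rat k : is_ratmap X (Gm K q.+1) (Th k).
  apply: (is_ratmap_torus (y := y k) (e := e k)) => // [P|i]; first exact: videal_eval.
  by rewrite NE mulf_neq0 ?u_neq0.
pose c (i : 'I_q.+1) := if i == ord_max then C else 1.
have c0 i : c i != 0 by rewrite /c; case: ifP; rewrite ?oner_eq0.
have PhiE l : exists kap, evalr (monmap c (companion a)) (pt l) = kap *: pt l.+1.
  exists ((\prod_k pt l 0 k) ^+ mon_shift (companion a)); apply/rowP => i.
  rewrite [LHS]mxE torus_pt_monmap => [|k]; last exact: u_neq0.
  rewrite !mxE; congr (_ * _); case: (unlift ord0 i) => // j.
  rewrite (monv_companion a (fun j => u (l + j)%N)) /c; case: eqP => [->|_].
    by rewrite -rec addSnnS.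
  by rewrite mul1r addSnnS.
have rcompE m m' (E : m'.+1.-tuple {mpoly K[m.+1]}) (F : m.+1.-tuple {mpoly K[n.+1]}) z :
    evalr (rcomp E F) z = evalr E (evalr F z).
  by apply/rowP => i; rewrite !mxE tnth_mktuple comp_meval.
have [[e' phi_hom] _ _ _] := phi_rat.
(* All the [Th k] represent the same rational map: [Th 0] names it, and [Th k] witnesses that it is
   defined at [y k]. *)
exists q.+1, (Th 0%N), c, (companion a); split=> //.
- by split=> //; apply: monmap_dominant => // m; apply: companion_inj.
- apply: (ratmap_eq_values (e := e' * \sum_l e 0%N l)
    (e' := (\sum_l e 0%N l) * (q.+2 * mon_shift (companion a)))).
  + by move=> i; rewrite tnth_mktuple; apply: dhomog_comp.
  + by move=> i; rewrite tnth_mktuple; apply: dhomog_comp => //; apply: monmap_homog.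
  move=> l; rewrite !rcompE ThE.
  have [mu ->] : exists mu, evalr phi (y l) = mu *: y l.+1.
    by apply: rat_at_rep phi_rat (yX l) (yS l) _ => i j; rewrite mulrC subrr rpred0.
  have [kap kapE] := PhiE l.
  rewrite (evalr_scale _ _ (Th_hom 0%N)) ThE.
  rewrite (evalr_scale _ _ (monmap_homog c (companion a))) kapE !scalerA.
  by eexists _, _, (pt l.+1).
- move=> k z [b b0 ->]; exists (evalr (Th k) (b *: y k)); exists (Th k); split=> //.
  + apply: (ratmap_eq_values (Th_hom 0%N) (Th_hom k)) => l; rewrite !ThE.
    by eexists _, _, (pt l).
  + apply: on_var_torus => i; rewrite -/(evalr (Th k) (b *: y k)).
    rewrite (evalr_scale _ _ (Th_hom k)) ThE !mxE !mulf_neq0 ?expf_neq0 //.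
      by apply/prodf_neq0 => j _.
    by case: (unlift ord0 i) => [j|]; rewrite ?u_neq0 ?oner_eq0.
  exact: same_pt_refl.
(* The first coordinate of the torus map is [f] itself. *)
exists (delta_mx 0 0).
have [[e'' f_hom] _ _ _] := f_rat.
apply: (ratmap_eq_values f_hom (e' := (\sum_l e 0%N l) * (q.+2 * mon_shift (delta_mx 0 0 : 'M[int]_(1, q.+1))))).
  by move=> i; rewrite tnth_mktuple; apply: dhomog_comp => //; apply: monmap_homog.
move=> l; rewrite rcompE ThE.
have [mu ->] : exists mu, evalr f (y l) = mu *: P1pt (u l).
  by apply: rat_at_rep f_rat (yX l) (yf l) _ => i j; rewrite mulrC subrr rpred0.
have [kap kapE] : exists kap,
    evalr (monmap (fun _ : 'I_1 => 1) (delta_mx 0 0 : 'M[int]_(1, q.+1))) (pt l) = kap *: P1pt (u l).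
  eexists; apply/rowP => i.
  rewrite [LHS]mxE torus_pt_monmap => [|k]; last exact: u_neq0.
  rewrite !mxE; congr (_ * _); case: unliftP => [j ->|->] //.
  by rewrite mul1r row_id monv_delta addn0.
rewrite (evalr_scale _ _ (monmap_homog _ _)) kapE scalerA.
by eexists _, _, (P1pt (u l)).
Qed.

End Orbit.

Theorem theorem1p2 (K : fieldType) (p : nat) (hp : p \in [pchar K])
    (n : nat) (X : qpvar K n)
    (phi : n.+1.-tuple {mpoly K[n.+1]})
    (phi_rat : is_ratmap X X phi) (phi_dom : dominant X X phi)
    (f : 2.-tuple {mpoly K[n.+1]})
    (f_rat : is_ratmap X (Pspace K 1) f) (f_dom : dominant X (Pspace K 1) f)
    (x0 : 'rV[K]_n.+1) (x0X : on_var X x0)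
    (h1 : forall y, forward_orbit X phi x0 y ->
            defined_at X X phi y /\ defined_at X (Pspace K 1) f y)
    (h2 : zariski_dense X (forward_orbit X phi x0))
    (G : {pred K}) (hG : fg_mul_subgroup G)
    (h3 : forall (k : nat) (y : 'rV[K]_n.+1), iter_at X phi k x0 y ->
            exists2 v, v \in G & rat_at X (Pspace K 1) f y (P1pt v)) :
  exists (d : nat) (Theta : d.+1.-tuple {mpoly K[n.+1]})
         (c : 'I_d -> K) (a : 'M[int]_d),
    let Phi := monmap c a in
    [/\ is_ratmap X (Gm K d) Theta,
        (forall i, c i != 0) /\ dominant (Gm K d) (Gm K d) Phi,
        ratmap_eq X (rcomp Theta phi) (rcomp Phi Theta),
        forall y, forward_orbit X phi x0 y -> defined_at X (Gm K d) Theta y &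
        exists (C : K) (i : 'rV[int]_d),
          C \in G /\
          ratmap_eq X f (rcomp (monmap (fun _ : 'I_1 => C) i) Theta)].
Proof.
have [G0 [G1 Gdiv] [s sG genG]] := hG.
pose g (i : 'I_(size s)) := s`_i.
have g0 i : g i != 0.
  by apply: contraNneq G0 => <-; apply: sG; apply: mem_nth.
have nxt z : exists z', (exists k, iter_at X phi k x0 z) -> rat_at X X phi z z'.
  have [/h1[[z' hz'] _]|no] := pselect (exists k, iter_at X phi k x0 z); last by exists 0.
  by exists z'.
have [nx hnx] := choice nxt.
pose y k := iter k nx x0.
have yit k : iter_at X phi k x0 (y k).
  elim: k => [|k IH]; first exact: same_pt_refl.
  by exists (y k) => //; apply: hnx; exists k.
have yS k : rat_at X X phi (y k) (y k.+1) by apply: hnx; exists k.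
have yX k : on_var X (y k).
  by case: k => [//|k]; apply: rat_at_on_var (yS k).
have yuniq k z : iter_at X phi k x0 z -> same_pt (y k) z.
  elim: k z => [//|k IH] z [w hw wz].
  exact: rat_at_unique phi_rat (yX k) (IH _ hw) (yS k) wz.
have ydense P : P \is homog mdeg -> (forall k, P.@[y k ord0] = 0) -> P \in videal X.
  move=> hP P0; apply: h2 => // z [k /yuniq[c c0 ->]].
  by have /homogP[d hd] := hP; rewrite (dhomog_meval_scale _ _ hd) P0 mulr0.
have hu k : exists v, v \in G /\ rat_at X (Pspace K 1) f (y k) (P1pt v).
  by have [v ? ?] := h3 k _ (yit k); exists v.
have [u {}hu] := choice hu.
have u_val k : exists e, u k = monv g e.
  have [e ->] := genG _ (hu k).1; exists (\row_i e i).
  by apply: eq_bigr => i _; rewrite mxE.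
have yf k := (hu k).2.
have [d [Th [c [a [hT hc hTh hdef [i hi]]]]]] :=
  orbit_torus yX ydense g0 phi_rat yS f_rat yf u_val phi_dom hp.
exists d, Th, c, a; split=> //; first by move=> z [k /yuniq]; apply: hdef.
by exists 1, i.
Qed.
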